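(* Given a probability distribution $P = p_1, \ldots, p_n$ and a real number $c \geq 1$, we can construct a probability distribution $Q = q_1, \ldots, q_n$ with $D(P \| Q) \leq c \cdot H(P) + \log(\pi^2 / 3)$ and store $Q$ exactly in at most $\lfloor n^{1/(c+1)} \rfloor (\lfloor \log n \rfloor + 1)$ bits of space. Constructing, storing and recovering $Q$ each take $O(n)$ time.
   Context: A probability distribution $P = p_1, \ldots, p_n$ is simply a (finite, ordered) sequence of non-negative real numbers that sum to $1$; the sample space is not stored. $\log$ means $\log_2$. The entropy of $P$ is $H(P) = \sum_{i=1}^n p_i \log \frac{1}{p_i}$ and the relative entropy of $P$ with respect to $Q$ is $D(P \| Q) = \sum_{i=1}^n p_i \log \frac{p_i}{q_i}$ (terms with $p_i = 0$ contribute $0$). ''Storing $Q$ exactly in at most $m$ bits'' means that $Q$ is encoded by a binary string of at most $m$ bits from which (with $n$ and $c$ known) the whole sequence $q_1, \ldots, q_n$ can be recovered exactly. Time is the number of elementary steps of the corresponding algorithm (constructing $Q$ from $P$ and $c$, producing the binary string, and recovering $Q$ from the string). *)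

(* Defs.v *)
From Stdlib Require Import Reals List Arith ZArith.
From Coquelicot Require Import Coquelicot.
Open Scope R_scope.

(** * Distributions *)

Definition sumR (l : list R) : R := fold_right Rplus 0 l.

Definition distribution (P : list R) : Prop :=
  (forall p, In p P -> 0 <= p) /\ sumR P = 1.

Definition log2 (x : R) : R := ln x / ln 2.

(* A zero entry contributes [0 * _ = 0]. *)
Definition entropy (P : list R) : R :=
  sumR (map (fun p => p * log2 (1 / p)) P).

(* The second branch is the usual convention [p log (p / 0) = +oo] for
   [p > 0]; without it the total functions [/] and [ln] would give
   [p log (p / 0)] a meaningless finite value. *)
Definition relative_entropy_term (p q : R) : Rbar :=
  if Req_EM_T p 0 then Finite 0
  else if Req_EM_T q 0 then p_infty
  else Finite (p * log2 (p / q)).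

(* Only used on sequences of the same length.  No term is [m_infty] when the
   entries are non-negative, so [Rbar_plus] never meets [+oo - oo]. *)
Definition relative_entropy (P Q : list R) : Rbar :=
  fold_right Rbar_plus (Finite 0)
    (map (fun pq => relative_entropy_term (fst pq) (snd pq)) (combine P Q)).

(** * A real RAM

    Programs of a unit-cost random access machine with separate memories for
    natural numbers and for real numbers.  Natural numbers support addition and
    truncated subtraction and serve as addresses; real numbers support the
    field operations, [exp] and [ln], and are exact.  A natural number can be
    converted to a real, but there is no rounding from reals to natural numbers:
    reals influence the rest of the computation only through comparisons.

    Each memory is a family of infinite arrays.  The array named in an
    instruction is a constant of the program, so a program has access to a
    fixed finite number of arrays; the index in the array is computed. *)

Record state := State {
  ints : nat -> nat -> nat;
  reals : nat -> nat -> R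
}.

Inductive iexpr :=
| ICst (k : nat)
| IGet (a : nat) (i : iexpr)
| IAdd (e1 e2 : iexpr)
| ISub (e1 e2 : iexpr).

(* The only constants are the natural numbers, through [ROfInt]: arbitrary real
   constants would make programs non-uniform. *)
Inductive rexpr :=
| ROfInt (e : iexpr)
| RGet (a : nat) (i : iexpr)
| RAdd (e1 e2 : rexpr)
| RSub (e1 e2 : rexpr)
| RMul (e1 e2 : rexpr)
| RDiv (e1 e2 : rexpr)
| RExp (e : rexpr)
| RLn (e : rexpr).

Inductive bexpr :=
| ILt (e1 e2 : iexpr)
| RLt (e1 e2 : rexpr)
| BNot (b : bexpr)
| BAnd (b1 b2 : bexpr).

Inductive com :=
| Skip
| ISet (a : nat) (i e : iexpr)
| RSet (a : nat) (i : iexpr) (e : rexpr)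
| Seq (p1 p2 : com)
| If (b : bexpr) (p1 p2 : com)
| While (b : bexpr) (p : com).

Fixpoint ieval (st : state) (e : iexpr) : nat :=
  match e with
  | ICst k => k
  | IGet a i => ints st a (ieval st i)
  | IAdd e1 e2 => (ieval st e1 + ieval st e2)%nat
  | ISub e1 e2 => (ieval st e1 - ieval st e2)%nat
  end.

Fixpoint reval (st : state) (e : rexpr) : R :=
  match e with
  | ROfInt e => INR (ieval st e)
  | RGet a i => reals st a (ieval st i)
  | RAdd e1 e2 => reval st e1 + reval st e2
  | RSub e1 e2 => reval st e1 - reval st e2
  | RMul e1 e2 => reval st e1 * reval st e2
  | RDiv e1 e2 => reval st e1 / reval st e2
  | RExp e => exp (reval st e)
  | RLn e => ln (reval st e)
  end.

Fixpoint beval (st : state) (b : bexpr) : bool :=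
  match b with
  | ILt e1 e2 => Nat.ltb (ieval st e1) (ieval st e2)
  | RLt e1 e2 => if Rlt_dec (reval st e1) (reval st e2) then true else false
  | BNot b => negb (beval st b)
  | BAnd b1 b2 => andb (beval st b1) (beval st b2)
  end.

(* The cost of an expression is its number of operations: every constant,
   memory access, arithmetic operation, comparison and connective is one
   elementary step. *)
Fixpoint icost (e : iexpr) : nat :=
  match e with
  | ICst _ => 1
  | IGet _ i => S (icost i)
  | IAdd e1 e2 | ISub e1 e2 => S (icost e1 + icost e2)
  end.

Fixpoint rcost (e : rexpr) : nat :=
  match e with
  | ROfInt e => S (icost e)
  | RGet _ i => S (icost i)
  | RAdd e1 e2 | RSub e1 e2 | RMul e1 e2 | RDiv e1 e2 =>
      S (rcost e1 + rcost e2)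
  | RExp e | RLn e => S (rcost e)
  end.

Fixpoint bcost (b : bexpr) : nat :=
  match b with
  | ILt e1 e2 => S (icost e1 + icost e2)
  | RLt e1 e2 => S (rcost e1 + rcost e2)
  | BNot b => S (bcost b)
  | BAnd b1 b2 => S (bcost b1 + bcost b2)
  end.

Definition update {A : Type} (m : nat -> nat -> A) (a i : nat) (x : A)
    : nat -> nat -> A :=
  fun a' i' => if andb (Nat.eqb a' a) (Nat.eqb i' i) then x else m a' i'.

(* [exec p st k st']: started in [st], [p] halts in [st'] after [k] steps. *)
Inductive exec : com -> state -> nat -> state -> Prop :=
| exec_Skip st : exec Skip st 1 st
| exec_ISet a i e st :
    exec (ISet a i e) st (S (icost i + icost e))
      (State (update (ints st) a (ieval st i) (ieval st e)) (reals st))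
| exec_RSet a i e st :
    exec (RSet a i e) st (S (icost i + rcost e))
      (State (ints st) (update (reals st) a (ieval st i) (reval st e)))
| exec_Seq p1 p2 st1 st2 st3 k1 k2 :
    exec p1 st1 k1 st2 -> exec p2 st2 k2 st3 ->
    exec (Seq p1 p2) st1 (k1 + k2) st3
| exec_If b p1 p2 st st' k :
    exec (if beval st b then p1 else p2) st k st' ->
    exec (If b p1 p2) st (S (bcost b + k)) st'
| exec_While_false b p st :
    beval st b = false -> exec (While b p) st (S (bcost b)) st
| exec_While_true b p st1 st2 st3 k1 k2 :
    beval st1 b = true ->
    exec p st1 k1 st2 -> exec (While b p) st2 k2 st3 ->
    exec (While b p) st1 (S (bcost b + k1 + k2)) st3.

(** * Input and output

    Integer cell [0, 0] holds the length [n] of the distribution, integer cell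
    [0, 1] the length of the binary string and integer array [1] its bits;
    real cell [0, 0] holds [c] and real array [1] the distribution.  All the
    other cells are initially zero. *)

Definition distribution_input (c : R) (P : list R) : state :=
  State
    (fun a i => match a, i with 0%nat, 0%nat => length P | _, _ => 0%nat end)
    (fun a i => match a, i with
                | 0%nat, 0%nat => c
                | 1%nat, _ => nth i P 0
                | _, _ => 0
                end).

Definition string_input (n : nat) (c : R) (s : list bool) : state :=
  State
    (fun a i => match a, i with
                | 0%nat, 0%nat => n
                | 0%nat, 1%nat => length s
                | 1%nat, _ => Nat.b2n (nth i s false)
                | _, _ => 0%nat
                end)
    (fun a i => match a, i with 0%nat, 0%nat => c | _, _ => 0 end).

Definition distribution_output (n : nat) (st : state) : list R :=
  map (reals st 1) (seq 0 n).

Definition string_output (st : state) : list bool :=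
  map (fun i => Nat.eqb (ints st 1 i) 1) (seq 0 (ints st 0 1)).

Definition computes_within {A : Type} (p : com) (input : state)
    (output : state -> A) (T : nat) (x : A) : Prop :=
  exists k st, exec p input k st /\ (k <= T)%nat /\ output st = x.

(* Main.v *)
(** Let [t + 1] be the least positive integer that is at least [n^(1/(c+1))], so
    that [t < n^(1/(c+1))] and [t^2 < n].  Fewer than [t + 1] of the [p_i]
    exceed [1/(t+1)]; list their indices as [h_0, h_1, ...] so that
    [p_(h_j) <= 1/(j+1)], and let [Q] be the mixture of mass [1/(3 (j+1)^2)] on
    each [h_j] and the remaining mass, at least [1/3], spread uniformly over
    all [n] indices.  Then [q_i >= p_i^(c+1) / 3] for every [i]: through the
    point mass if [i] is listed, since [c + 1 >= 2], and through the uniform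
    part otherwise, since then [p_i <= n^(-1/(c+1))].  Hence
    [D(P||Q) <= c H(P) + log 3], and [3 <= pi^2/3].

    The list is stored with [floor (log n) + 1] bits per index.  No comparison
    sort is needed: for [r < t], the indices with [1/(r+2) < p_i <= 1/(r+1)] are
    appended in turn, and at most [r + 1] indices have been listed after round
    [r].  This takes [O(t^2) = O(n)] steps.  As [min Q] is the uniform part, the
    same ranking, applied to [3 (q_i - min Q)], recovers the list from [Q]; the
    programs therefore rank squares of probabilities. *)

Require Import Defs.
From Stdlib Require Import Reals List Arith ZArith.
From Coquelicot Require Import Coquelicot.
From Stdlib Require Import Lia Lra Bool.
Import ListNotations.
Open Scope R_scope.
Set Bullet Behavior "Strict Subproofs".

(** * Running programs *)

Open Scope nat_scope.

(** A total-correctness triple at a fixed initial state, with a time bound. [computes_within]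
    unfolds to it, the postcondition being the equation for the output. *)
Definition runs (p : com) (st : state) (T : nat) (Post : state -> Prop) : Prop :=
  exists k st', exec p st k st' /\ k <= T /\ Post st'.

Lemma runs_weaken p st T T' (Post Post' : state -> Prop) :
  runs p st T Post -> T <= T' -> (forall st', Post st' -> Post' st') ->
  runs p st T' Post'.
Proof.
  intros (k & st' & He & Hk & HP) HT H.
  exists k, st'. repeat split; auto. lia.
Qed.

Lemma runs_seq p1 p2 st T1 T2 (Mid Post : state -> Prop) :
  runs p1 st T1 Mid -> (forall st', Mid st' -> runs p2 st' T2 Post) ->
  runs (Seq p1 p2) st (T1 + T2) Post.
Proof.
  intros (k1 & st1 & He1 & Hk1 & HM) H.
  destruct (H st1 HM) as (k2 & st2 & He2 & Hk2 & HP).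
  exists (k1 + k2), st2. repeat split; auto; [|lia].
  econstructor; eauto.
Qed.

(** The number [N] of iterations is fixed beforehand and [Inv] is indexed by the iterations already
    done, so induction on those that remain gives termination and the time bound together. *)
Lemma runs_while b p N T (Inv : nat -> state -> Prop) st :
  (forall i st, i < N -> Inv i st ->
     beval st b = true /\ runs p st T (Inv (S i))) ->
  (forall st, Inv N st -> beval st b = false) ->
  Inv 0 st ->
  runs (While b p) st (S (bcost b) + N * (S (bcost b) + T)) (Inv N).
Proof.
  intros Hbody Hend H0.
  assert (H : forall m i st, i + m = N -> Inv i st ->
    runs (While b p) st (S (bcost b) + m * (S (bcost b) + T)) (Inv N)).
  { clear st H0. induction m as [|m IH]; intros i st Hi HI.
    - assert (i = N) by lia. subst i.
      exists (S (bcost b)), st. repeat split; auto; [|lia].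
      constructor. auto.
    - destruct (Hbody i st ltac:(lia) HI) as [Hb (k & st1 & He & Hk & HI1)].
      destruct (IH (S i) st1 ltac:(lia) HI1) as (k2 & st2 & He2 & Hk2 & HI2).
      exists (S (bcost b + k + k2)), st2. repeat split; auto; [|simpl in *; lia].
      econstructor; eauto. }
  apply (H N 0); auto.
Qed.

(* [straight], [step] and [cost] describe loop-free programs; their value on
   [While] is irrelevant. *)
Fixpoint straight (p : com) : bool :=
  match p with
  | Seq p1 p2 | If _ p1 p2 => straight p1 && straight p2
  | While _ _ => false
  | _ => true
  end.

Fixpoint step (p : com) (st : state) : state :=
  match p with
  | ISet a i e =>
      State (update (ints st) a (ieval st i) (ieval st e)) (reals st)
  | RSet a i e =>
      State (ints st) (update (reals st) a (ieval st i) (reval st e))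
  | Seq p1 p2 => step p2 (step p1 st)
  | If b p1 p2 => if beval st b then step p1 st else step p2 st
  | Skip | While _ _ => st
  end.

Fixpoint cost (p : com) : nat :=
  match p with
  | ISet _ i e => S (icost i + icost e)
  | RSet _ i e => S (icost i + rcost e)
  | Seq p1 p2 => cost p1 + cost p2
  | If b p1 p2 => S (bcost b + (cost p1 + cost p2))
  | Skip | While _ _ => 1
  end.

(** Reduces a loop-free block to symbolic evaluation of [step]. As [cost] charges both branches of a
    conditional, it only bounds the actual time from above. *)
Lemma runs_straight p st T (Post : state -> Prop) :
  straight p = true -> cost p <= T -> Post (step p st) -> runs p st T Post.
Proof.
  intros Hs HT HP.
  enough (H : forall st, exists k, exec p st k (step p st) /\ k <= cost p).
  { destruct (H st) as (k & He & Hk). exists k, (step p st). repeat split; auto. lia. }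
  clear HT HP st T Post.
  induction p; intro st; simpl in Hs |- *; try discriminate;
    try (eexists; split; [constructor|lia]);
    apply andb_prop in Hs as [Hs1 Hs2];
    specialize (IHp1 Hs1); specialize (IHp2 Hs2).
  - destruct (IHp1 st) as (k1 & He1 & Hk1).
    destruct (IHp2 (step p1 st)) as (k2 & He2 & Hk2).
    exists (k1 + k2). split; [econstructor; eauto|lia].
  - destruct (beval st b) eqn:Hb;
      [destruct (IHp1 st) as (k & He & Hk)|destruct (IHp2 st) as (k & He & Hk)];
      exists (S (bcost b + k)); (split; [constructor; rewrite Hb; auto|lia]).
Qed.

(* Array [0] of the integers holds the scalars: cell 0 is [n], 1 the length of
   the string, 2 [t], 3 the number of heavy indices, 4 and 5 loop counters, 6
   the length of the ranking, 7 the number of bits of an index, 8 its power of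
   two, 9 the index being coded.  Array [2] holds the heavy indices and array [3]
   their ranking; array [2] of the reals holds the values to be ranked. *)
Definition cell (x : nat) : iexpr := IGet 0 (ICst x).
Definition set (x : nat) (e : iexpr) : com := ISet 0 (ICst x) e.
Definition incr (x : nat) : com := set x (IAdd (cell x) (ICst 1)).

Definition For (x : nat) (e : iexpr) (p : com) : com :=
  Seq (set x (ICst 0)) (While (ILt (cell x) e) (Seq p (incr x))).

(** For [y = p^2] and [p >= 0] this is the test [p > 1/m], free of division and square roots. *)
Definition rabove (y : rexpr) (m : iexpr) : bexpr :=
  RLt (ROfInt (ICst 1)) (RMul y (RMul (ROfInt m) (ROfInt m))).

Definition root_expr : rexpr :=
  RExp (RMul (RDiv (ROfInt (ICst 1)) (RAdd (RGet 0 (ICst 0)) (ROfInt (ICst 1))))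
             (RLn (ROfInt (cell 0)))).

Ltac ev := cbn [step ieval reval beval ints reals update andb Nat.eqb cell set incr
                negb rabove root_expr]; unfold update; cbn [andb Nat.eqb].

Ltac ec := cbn [cost icost rcost bcost cell set incr rabove root_expr].

(** The bound [e] is evaluated again in every round, so the invariant must fix its value. The body
    is judged after the increment, which keeps the index of [Inv] equal to the counter. *)
Lemma runs_for x e p N T (Inv : nat -> state -> Prop) st :
  Inv 0 (step (set x (ICst 0)) st) ->
  (forall i st, Inv i st -> ints st 0 x = i /\ ieval st e = N) ->
  (forall i st, i < N -> Inv i st ->
     runs p st T (fun st' => Inv (S i) (step (incr x) st'))) ->
  runs (For x e p) st (icost e + 10 + N * (T + icost e + 10)) (Inv N).
Proof.
  intros H0 Hx Hbody.
  eapply runs_weaken with (T := 3 + (S (bcost (ILt (cell x) e))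
    + N * (S (bcost (ILt (cell x) e)) + (T + 6)))) (Post := Inv N); [|simpl; nia|auto].
  eapply runs_seq with (Mid := Inv 0).
  - apply runs_straight; auto.
  - intros st' H. apply runs_while with (Inv := Inv); auto.
    + intros i s Hi HI. destruct (Hx _ _ HI) as [Hxi HN]. split.
      * ev. rewrite HN, Hxi. apply Nat.ltb_lt; auto.
      * eapply runs_seq; [apply (Hbody i); auto|].
        intros s' Hs'. apply runs_straight; auto.
    + intros s' HI. destruct (Hx _ _ HI) as [Hxi HN].
      ev. rewrite HN, Hxi. apply Nat.ltb_irrefl.
Qed.

(** * Lists stored as initial segments of arrays *)

Definition listing {A : Type} (f : nat -> A) (m : nat) (l : list A) : Prop :=
  map f (seq 0 m) = l.

Lemma listing_length {A : Type} (f : nat -> A) m l :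
  listing f m l -> m = length l.
Proof. intros <-. rewrite length_map, length_seq. reflexivity. Qed.

Lemma listing_nth {A : Type} (f : nat -> A) m l i d :
  listing f m l -> i < length l -> f i = nth i l d.
Proof.
  intros <- Hi. rewrite length_map, length_seq in Hi.
  rewrite nth_indep with (d' := f 0) by (rewrite length_map, length_seq; auto).
  rewrite map_nth, seq_nth; auto.
Qed.

Lemma listing_ext {A : Type} (f g : nat -> A) m l :
  listing f m l -> (forall i, i < m -> g i = f i) -> listing g m l.
Proof.
  unfold listing. intros <- H. apply map_ext_in.
  intros i Hi. apply in_seq in Hi. apply H. lia.
Qed.

Lemma listing_snoc {A : Type} (f g : nat -> A) m l x :
  listing f m l -> (forall i, i < m -> g i = f i) -> g m = x ->
  listing g (m + 1) (l ++ [x]).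
Proof.
  intros Hl H <-. apply (listing_ext _ g) in Hl; auto. unfold listing in *.
  rewrite seq_app, map_app, Hl. reflexivity.
Qed.

Lemma firstn_snoc {A : Type} (l : list A) i d :
  i < length l -> firstn (S i) l = firstn i l ++ [nth i l d].
Proof.
  revert i. induction l as [|x l IH]; intros [|i] Hi; simpl in *; try lia; auto.
  rewrite <- IH by lia. reflexivity.
Qed.

(** * Programs that rank the heavy indices *)

Definition above (y m : R) : bool := if Rlt_dec 1 (y * (m * m)) then true else false.

Definition root (n : nat) (c : R) : R := Rpower (INR n) (1 / (c + 1)).

Definition compute_t : com :=
  Seq (set 2 (ICst 0))
      (While (RLt (ROfInt (IAdd (cell 2) (ICst 1))) root_expr) (incr 2)).

Definition compute_heavy : com :=
  Seq (set 3 (ICst 0))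
    (For 4 (cell 0)
       (If (rabove (RGet 2 (cell 4)) (IAdd (cell 2) (ICst 1)))
           (Seq (ISet 2 (cell 3) (cell 4)) (incr 3)) Skip)).

Definition order_heavy : com :=
  Seq (set 6 (ICst 0))
    (For 4 (cell 2)
       (For 5 (cell 3)
          (If (BAnd (rabove (RGet 2 (IGet 2 (cell 5))) (IAdd (cell 4) (ICst 2)))
                    (BNot (rabove (RGet 2 (IGet 2 (cell 5))) (IAdd (cell 4) (ICst 1)))))
              (Seq (ISet 3 (cell 6) (IGet 2 (cell 5))) (incr 6)) Skip))).

Definition rank_com : com := Seq compute_t (Seq compute_heavy order_heavy).

Definition heavy (n t : nat) (y : nat -> R) : list nat :=
  filter (fun i => above (y i) (INR (t + 1))) (seq 0 n).

Definition bucket (y : nat -> R) (r : nat) (l : list nat) : list nat :=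
  filter (fun i => above (y i) (INR (r + 2)) && negb (above (y i) (INR (r + 1)))) l.

Definition ranking (y : nat -> R) (l : list nat) (t : nat) : list nat :=
  flat_map (fun r => bucket y r l) (seq 0 t).

Lemma ranking_S y l t : ranking y l (S t) = ranking y l t ++ bucket y t l.
Proof. unfold ranking. rewrite seq_S, flat_map_app. simpl. now rewrite app_nil_r. Qed.

(** Says that [t + 1] is the ceiling of [x]. The predecessor is named because it bounds the length
    of the list. *)
Definition ceiling_spec (t : nat) (x : R) : Prop := (INR t < x <= INR (t + 1))%R.

(** Without a rounding instruction the ceiling is found by counting up to the root; each test
    recomputes the root in constant time, and [t <= n] makes the count linear. *)
Lemma compute_t_runs n m t c st :
  1 <= n -> t <= n -> reals st 0 0 = c ->
  ceiling_spec t (root n c) -> ints st 0 0 = n -> ints st 0 1 = m ->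
  runs compute_t st (100 * n)
    (fun st' => ints st' 0 0 = n /\ ints st' 0 1 = m /\ reals st' = reals st /\
                ints st' 0 2 = t).
Proof.
  intros Hn Htn Hc [Ht1 Ht2] H0 H1.
  set (Inv := fun i st' => ints st' 0 0 = n /\ ints st' 0 1 = m /\ reals st' = reals st /\
                ints st' 0 2 = i).
  eapply runs_weaken.
  - eapply runs_seq with (Mid := Inv 0).
    + apply runs_straight; auto. unfold Inv. ev. auto.
    + intros st' HI. apply runs_while with (N := t) (T := 6) (Inv := Inv); auto.
      * intros i s Hi (A0 & A1 & A2 & A3). split.
        -- ev. rewrite A0, A2, A3, Hc. destruct Rlt_dec as [|F]; auto.
           exfalso. apply F. eapply Rle_lt_trans; [|exact Ht1].
           apply le_INR. lia.
        -- apply runs_straight; auto. unfold Inv. ev. repeat split; auto. lia.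
      * intros s (A0 & A1 & A2 & A3).
        ev. rewrite A0, A2, A3, Hc. destruct Rlt_dec as [F|]; auto.
        exfalso. unfold root, Rpower in Ht2. eapply Rlt_irrefl, Rlt_le_trans; [exact F|exact Ht2].
  - ec. nia.
  - intros st' H. exact H.
Qed.

Lemma compute_heavy_runs n m t y st :
  1 <= n -> (forall i, reals st 2 i = y i) ->
  ints st 0 0 = n -> ints st 0 1 = m -> ints st 0 2 = t ->
  runs compute_heavy st (100 * n)
    (fun st' => ints st' 0 0 = n /\ ints st' 0 1 = m /\ reals st' = reals st /\
                ints st' 0 2 = t /\
                listing (ints st' 2) (ints st' 0 3) (heavy n t y)).
Proof.
  intros Hn Hy H0 H1 H2.
  set (Inv := fun i st' => ints st' 0 0 = n /\ ints st' 0 1 = m /\ reals st' = reals st /\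
                ints st' 0 2 = t /\ ints st' 0 4 = i /\
                listing (ints st' 2) (ints st' 0 3) (heavy i t y)).
  eapply runs_weaken.
  (* The invariant is asserted for the state after the counter is reset, the form in which
     [runs_for] asks for it. *)
  - eapply runs_seq with (T1 := 3) (Mid := fun st' => Inv 0 (step (set 4 (ICst 0)) st')).
    + apply runs_straight; auto. unfold Inv. ev. repeat split; auto.
    + intros st' HI. apply runs_for with (N := n) (T := 40) (Inv := Inv); auto.
      * intros i s (A0 & A1 & A2 & A3 & A4 & A5). split; auto.
      * intros i s Hi (A0 & A1 & A2 & A3 & A4 & A5).
        apply runs_straight; [auto|ec; lia|].
        unfold Inv, heavy in *. ev.
        rewrite A2, A3, A4, Hy, seq_S, filter_app, Nat.add_0_l. cbn [filter].
        change (if Rlt_dec (INR 1) (y i * (INR (t + 1) * INR (t + 1))) then true else false)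
          with (above (y i) (INR (t + 1))).
        destruct (above (y i) (INR (t + 1))); ev; rewrite ?app_nil_r;
          repeat split; auto; try lia.
        eapply listing_snoc; [exact A5| |].
        -- intros j Hj. ev. destruct (Nat.eqb_spec j (ints s 0 3)); [lia|auto].
        -- ev. rewrite Nat.eqb_refl. auto.
  - ec. nia.
  - intros st' (A0 & A1 & A2 & A3 & A4 & A5). auto.
Qed.

(** There are [t] rounds over at most [t] indices, hence a quadratic cost in [t], which [t * t <= n]
    makes linear in [n]. Within round [r], the inner invariant adds the part of the bucket found in
    the prefix scanned so far. *)
Lemma order_heavy_runs n m t y l st :
  1 <= n -> t * t <= n -> length l <= t -> (forall i, reals st 2 i = y i) ->
  ints st 0 0 = n -> ints st 0 1 = m -> ints st 0 2 = t ->
  listing (ints st 2) (ints st 0 3) l ->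
  runs order_heavy st (300 * n)
    (fun st' => ints st' 0 0 = n /\ ints st' 0 1 = m /\ reals st' = reals st /\
                listing (ints st' 3) (ints st' 0 6) (ranking y l t)).
Proof.
  intros Hn Ht Hlt Hy H0 H1 H2 H3.
  set (Frame := fun st' => ints st' 0 0 = n /\ ints st' 0 1 = m /\ reals st' = reals st /\
                ints st' 0 2 = t /\ listing (ints st' 2) (ints st' 0 3) l).
  set (Inv := fun r st' => Frame st' /\ ints st' 0 4 = r /\
                listing (ints st' 3) (ints st' 0 6) (ranking y l r)).
  set (Inv' := fun r i st' => Frame st' /\ ints st' 0 4 = r /\ ints st' 0 5 = i /\
                listing (ints st' 3) (ints st' 0 6)
                  (ranking y l r ++ bucket y r (firstn i l))).
  eapply runs_weaken.
  - eapply runs_seq with (T1 := 3) (Mid := fun st' => Inv 0 (step (set 4 (ICst 0)) st')).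
    + apply runs_straight; auto. unfold Inv, Frame. ev. repeat split; auto.
    + intros st' HI. apply runs_for with (N := t) (T := 100 * t + 20) (Inv := Inv); auto.
      * intros i s ((A0 & A1 & A2 & A3 & A4) & A5 & A6). split; auto.
      * intros r s Hr HIr. eapply runs_weaken.
        -- apply runs_for with (N := length l) (T := 80) (Inv := Inv' r).
           ++ destruct HIr as ((A0 & A1 & A2 & A3 & A4) & A5 & A6).
              unfold Inv', Frame. ev. rewrite app_nil_r. repeat split; auto.
           ++ intros i s' ((A0 & A1 & A2 & A3 & A4) & A5 & A6 & A7). split; auto.
              ev. eapply listing_length; eauto.
           ++ intros i s' Hi ((A0 & A1 & A2 & A3 & A4) & A5 & A6 & A7).
              apply runs_straight; [auto|ec; lia|].
              pose proof (listing_nth _ _ _ i 0 A4 Hi) as Hnth.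
              unfold Inv', Frame, bucket in *.
              rewrite (firstn_snoc l i 0) by auto. rewrite filter_app. cbn [filter].
              ev. rewrite A2, A5, A6, Hnth, Hy.
              set (z := nth i l 0) in *.
              change (if Rlt_dec (INR 1) (y z * (INR (r + 2) * INR (r + 2))) then true else false)
                with (above (y z) (INR (r + 2))).
              change (if Rlt_dec (INR 1) (y z * (INR (r + 1) * INR (r + 1))) then true else false)
                with (above (y z) (INR (r + 1))).
              destruct (above (y z) (INR (r + 2)) && negb (above (y z) (INR (r + 1))));
                ev; rewrite ?app_nil_r; repeat split; auto; try lia.
              rewrite app_assoc.
              eapply listing_snoc; [exact A7| |].
              ** intros j Hj. ev. destruct (Nat.eqb_spec j (ints s' 0 6)); [lia|auto].
              ** ev. rewrite Nat.eqb_refl. auto.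
        -- ec. nia.
        -- intros s' ((A0 & A1 & A2 & A3 & A4) & A5 & A6 & A7).
           unfold Inv, Frame. rewrite firstn_all in A7. rewrite ranking_S.
           ev. repeat split; auto. lia.
  - ec. nia.
  - intros st' ((A0 & A1 & A2 & A3 & A4) & A5 & A6). auto.
Qed.

Lemma heavy_ext n t y y' :
  (forall i, i < n -> y i = y' i) -> heavy n t y = heavy n t y'.
Proof.
  intro H. apply filter_ext_in. intros i Hi. apply in_seq in Hi.
  rewrite H; auto. lia.
Qed.

Lemma ranking_ext y y' l t :
  (forall i, In i l -> y i = y' i) -> ranking y l t = ranking y' l t.
Proof.
  intro H. apply flat_map_ext. intro r. apply filter_ext_in.
  intros i Hi. now rewrite H.
Qed.

Lemma rank_com_runs n m t c y st :
  1 <= n -> t * t <= n -> length (heavy n t y) <= t ->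
  (forall i, i < n -> reals st 2 i = y i) ->
  reals st 0 0 = c -> ceiling_spec t (root n c) ->
  ints st 0 0 = n -> ints st 0 1 = m ->
  runs rank_com st (500 * n)
    (fun st' => ints st' 0 0 = n /\ ints st' 0 1 = m /\ reals st' = reals st /\
                listing (ints st' 3) (ints st' 0 6) (ranking y (heavy n t y) t)).
Proof.
  intros Hn Ht Hl Hy Hc Hs H0 H1.
  (* The lemmas on the two scans want the array to equal [y] at every index, but it does so only
     below [n]. The ranking is therefore restated for the array itself, which is harmless because
     heavy indices are below [n]. *)
  rewrite <- (heavy_ext _ t _ _ Hy) in *.
  rewrite <- (ranking_ext (reals st 2) y).
  2: { intros i Hi. apply filter_In in Hi as [Hi _]. apply in_seq in Hi. apply Hy. lia. }
  eapply runs_weaken.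
  - eapply runs_seq.
    + eapply (compute_t_runs n m t); eauto. nia.
    + intros s1 (A0 & A1 & A2 & A3).
      eapply runs_seq.
      * eapply (compute_heavy_runs n m t (reals st 2)); eauto. now rewrite A2.
      * intros s2 (B0 & B1 & B2 & B3 & B4).
        assert (E : reals s2 = reals st) by congruence.
        eapply runs_weaken;
          [eapply (order_heavy_runs n m t (reals st 2)); eauto; now rewrite E|reflexivity|].
        intros s3 (C0 & C1 & C2 & C3).
        exact (conj C0 (conj C1 (conj (eq_trans C2 E) C3))).
  - lia.
  - auto.
Qed.

(** * Linear-time programs *)

Definition fill (a : nat) (e : rexpr) : com := For 4 (cell 0) (RSet a (cell 4) e).

(** The hypothesis on [e] covers every state that differs from [st] only in the counter and in array
    [a]: the expression may depend on the counter but not on what has been filled in. *)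
Lemma fill_runs a e f n st :
  1 <= n -> rcost e <= 20 -> ints st 0 0 = n ->
  (forall i st', i < n ->
     (forall b j, b <> 0 \/ j <> 4 -> ints st' b j = ints st b j) ->
     ints st' 0 4 = i ->
     (forall b j, b <> a -> reals st' b j = reals st b j) ->
     reval st' e = f i) ->
  runs (fill a e) st (60 * n)
    (fun st' => (forall b j, b <> 0 \/ j <> 4 -> ints st' b j = ints st b j) /\
                (forall b j, b <> a -> reals st' b j = reals st b j) /\
                forall i, i < n -> reals st' a i = f i).
Proof.
  intros Hn He H0 Hf.
  set (Inv := fun i st' => ints st' 0 4 = i /\
    (forall b j, b <> 0 \/ j <> 4 -> ints st' b j = ints st b j) /\
    (forall b j, b <> a -> reals st' b j = reals st b j) /\
    forall j, j < i -> reals st' a j = f j).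
  assert (Hb : forall b j, b <> 0 \/ j <> 4 -> Nat.eqb b 0 && Nat.eqb j 4 = false).
  { intros b j [H|H]; [apply Nat.eqb_neq in H; now rewrite H|].
    apply Nat.eqb_neq in H; rewrite H. apply andb_false_r. }
  eapply runs_weaken.
  - apply runs_for with (N := n) (T := 25) (Inv := Inv).
    + unfold Inv. ev. repeat split; auto; [|lia].
      intros b j H. now rewrite Hb.
    + intros i s (A0 & A1 & A2 & A3). split; auto. ev. rewrite A1; auto.
    + intros i s Hi (A0 & A1 & A2 & A3). apply runs_straight; [auto|ec; lia|].
      unfold Inv. ev. rewrite A0, (Hf i s) by auto. repeat split; auto.
      * lia.
      * intros b j H. rewrite Hb by auto. auto.
      * intros b j H. apply Nat.eqb_neq in H as H'. rewrite H'. cbn [andb]. auto.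
      * intros j Hj. rewrite Nat.eqb_refl. cbn [andb].
        destruct (Nat.eqb_spec j i); [now subst|]. apply A3. lia.
  - ec. nia.
  - intros st' (A0 & A1 & A2 & A3). auto.
Qed.

Definition compute_min : com :=
  Seq (RSet 0 (ICst 1) (RGet 1 (ICst 0)))
    (For 4 (cell 0)
       (If (RLt (RGet 1 (cell 4)) (RGet 0 (ICst 1)))
           (RSet 0 (ICst 1) (RGet 1 (cell 4))) Skip)).

Lemma compute_min_runs n m c q mu st :
  1 <= n -> ints st 0 0 = n -> ints st 0 1 = m -> reals st 0 0 = c ->
  (forall i, i < n -> reals st 1 i = q i) ->
  (forall i, i < n -> (mu <= q i)%R) -> (exists i, i < n /\ q i = mu) ->
  runs compute_min st (60 * n)
    (fun st' => ints st' 0 0 = n /\ ints st' 0 1 = m /\ reals st' 0 0 = c /\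
                (forall i, i < n -> reals st' 1 i = q i) /\ reals st' 0 1 = mu).
Proof.
  intros Hn H0 H1 Hc Hq Hmu [i0 [Hi0 Hq0]].
  set (Inv := fun i st' => ints st' 0 0 = n /\ ints st' 0 1 = m /\ reals st' 0 0 = c /\
                (forall i, i < n -> reals st' 1 i = q i) /\ ints st' 0 4 = i /\
                (mu <= reals st' 0 1)%R /\
                forall j, j < i -> (reals st' 0 1 <= q j)%R).
  eapply runs_weaken.
  - eapply runs_seq with (T1 := 4) (Mid := fun st' => Inv 0 (step (set 4 (ICst 0)) st')).
    + apply runs_straight; auto. unfold Inv. ev. repeat split; auto.
      * rewrite Hq by lia. apply Hmu. lia.
      * lia.
    + intros st' HI. apply runs_for with (N := n) (T := 20) (Inv := Inv); auto.
      * intros i s (A0 & A1 & A2 & A3 & A4 & A5 & A6). auto.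
      * intros i s Hi (A0 & A1 & A2 & A3 & A4 & A5 & A6).
        apply runs_straight; [auto|ec; lia|].
        unfold Inv. ev. rewrite A4, A3 by auto.
        destruct Rlt_dec as [Hlt|Hge]; ev; repeat split; auto; try lia.
        -- intros j Hj. assert (j < i \/ j = i) as [Hj'| ->] by lia; [|lra].
           specialize (A6 j Hj'). lra.
        -- intros j Hj. assert (j < i \/ j = i) as [Hj'| ->] by lia; [auto|lra].
  - ec. nia.
  - intros st' (A0 & A1 & A2 & A3 & A4 & A5 & A6). repeat split; auto.
    (* The result is at least [mu] and at most [q i0 = mu]. *)
    specialize (A6 i0 Hi0). lra.
Qed.

(** * Fixed-width binary coding of a list of indices *)

Definition compute_bits : com :=
  Seq (Seq (set 7 (ICst 0)) (set 8 (ICst 1)))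
    (While (BNot (ILt (cell 0) (cell 8)))
       (Seq (set 8 (IAdd (cell 8) (cell 8))) (incr 7))).

Definition width (n : nat) : nat := S (Nat.log2 n).

(** Doubling stops at the first power of two above [n], whose exponent is [width n]; the logarithmic
    number of rounds is crudely bounded by [n]. *)
Lemma compute_bits_runs n m st :
  1 <= n -> ints st 0 0 = n -> ints st 0 1 = m ->
  runs compute_bits st (60 * n)
    (fun st' => ints st' 0 0 = n /\ ints st' 0 1 = m /\
                (forall b j, b <> 0 -> ints st' b j = ints st b j) /\
                ints st' 0 6 = ints st 0 6 /\ reals st' = reals st /\
                ints st' 0 7 = width n /\ ints st' 0 8 = 2 ^ width n).
Proof.
  intros Hn H0 H1.
  set (Inv := fun i st' => ints st' 0 0 = n /\ ints st' 0 1 = m /\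
                (forall b j, b <> 0 -> ints st' b j = ints st b j) /\
                ints st' 0 6 = ints st 0 6 /\ reals st' = reals st /\
                ints st' 0 7 = i /\ ints st' 0 8 = 2 ^ i).
  pose proof (Nat.log2_spec n ltac:(lia)) as [L1 L2].
  pose proof (Nat.log2_lt_lin n ltac:(lia)).
  assert (Hb : forall b j x, b <> 0 -> Nat.eqb b 0 && Nat.eqb j x = false).
  { intros b j x Hb. apply Nat.eqb_neq in Hb. now rewrite Hb. }
  eapply runs_weaken.
  - eapply runs_seq with (T1 := 6) (Mid := Inv 0).
    + apply runs_straight; auto. unfold Inv. ev. repeat split; auto.
      intros b j Hbj. now rewrite !Hb.
    + intros st' HI. apply runs_while with (N := width n) (T := 20) (Inv := Inv); auto.
      * intros i s Hi (A0 & A1 & A2 & A3 & A6 & A4 & A5). split.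
        -- ev. rewrite A0, A5. unfold width in Hi.
           assert (2 ^ i <= 2 ^ Nat.log2 n) by (apply Nat.pow_le_mono_r; lia).
           destruct (Nat.ltb_spec n (2 ^ i)); auto; lia.
        -- apply runs_straight; [auto|ec; lia|].
           unfold Inv. ev. rewrite A4, A5. cbn [Nat.pow]. repeat split; auto; try lia.
           intros b j Hbj. rewrite !Hb; auto.
      * intros s (A0 & A1 & A2 & A3 & A6 & A4 & A5). ev. rewrite A0, A5.
        destruct (Nat.ltb_spec n (2 ^ width n)); auto. unfold width in *. lia.
  - ec. unfold width. nia.
  - intros st' (A0 & A1 & A2 & A3 & A6 & A4 & A5). auto 8.
Qed.

(* Most significant bit first: [x < w] is doubled modulo [w], where
   [w = 2 ^ b], and the overflow is the next bit. *)
Fixpoint encode (w b x : nat) : list bool :=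
  match b with
  | 0 => []
  | S b => if x + x <? w then false :: encode w b (x + x)
           else true :: encode w b (x + x - w)
  end.

Lemma encode_length w b x : length (encode w b x) = b.
Proof.
  revert x. induction b as [|b IH]; intro x; simpl; auto.
  destruct (_ <? _); simpl; now rewrite IH.
Qed.

Definition decode_from (x : nat) (s : list bool) : nat :=
  fold_left (fun x (b : bool) => x + x + Nat.b2n b) s x.

Lemma decode_encode w b x : w = 2 ^ b -> x < w ->
  decode_from 0 (encode w b x) = x.
Proof.
  intros Hw Hx.
  (* Reading [e] bits after the prefix [d] yields [d * 2^e] plus the integer part of [y * 2^e / w],
     with remainder [z]. For [w = 2^e] and [d = 0] this is [y] itself. *)
  assert (H : forall e d y, y < w -> exists z,
    z < w /\ decode_from d (encode w e y) * w + z = d * 2 ^ e * w + y * 2 ^ e).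
  { induction e as [|e IH]; intros d y Hy; cbn [encode].
    - exists y. cbn. split; [auto|lia].
    - destruct (Nat.ltb_spec (y + y) w) as [Hlt|Hge].
      + destruct (IH (d + d + 0) (y + y) Hlt) as (z & Hz & E).
        exists z. split; auto. cbn [decode_from fold_left Nat.b2n] in *.
        unfold decode_from in *. cbn [fold_left Nat.b2n]. rewrite E.
        cbn [Nat.pow]. ring.
      + destruct (IH (d + d + 1) (y + y - w) ltac:(lia)) as (z & Hz & E).
        exists z. split; auto. unfold decode_from in *. cbn [fold_left Nat.b2n].
        rewrite E. rewrite Nat.mul_sub_distr_r. cbn [Nat.pow].
        assert (w * 2 ^ e <= (y + y) * 2 ^ e) by (apply Nat.mul_le_mono_r; lia).
        nia. }
  destruct (H b 0 x Hx) as (z & Hz & E).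
  rewrite <- Hw in E. nia.
Qed.

Definition encode_list (n : nat) (h : list nat) : list bool :=
  flat_map (encode (2 ^ width n) (width n)) h.

Lemma encode_list_length n h : length (encode_list n h) = length h * width n.
Proof.
  induction h as [|x h IH]; auto. unfold encode_list in *.
  cbn [flat_map length]. rewrite length_app, encode_length, IH. lia.
Qed.

Lemma nth_encode_list n h j e d :
  j < length h -> e < width n ->
  nth (j * width n + e) (encode_list n h) d =
  nth e (encode (2 ^ width n) (width n) (nth j h 0)) d.
Proof.
  revert j. induction h as [|x h IH]; intros [|j] Hj He; cbn [length] in *; try lia;
    unfold encode_list; cbn [flat_map nth].
  - rewrite app_nth1; [auto|rewrite encode_length; lia].
  - rewrite app_nth2; rewrite encode_length; [|lia].
    rewrite <- (IH j) by lia. f_equal. lia.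
Qed.

Definition encode_com : com :=
  For 4 (cell 6)
    (Seq (set 9 (IGet 3 (cell 4)))
       (For 5 (cell 7)
          (Seq (set 9 (IAdd (cell 9) (cell 9)))
             (Seq (If (ILt (cell 9) (cell 8))
                      (ISet 1 (cell 1) (ICst 0))
                      (Seq (ISet 1 (cell 1) (ICst 1))
                           (set 9 (ISub (cell 9) (cell 8)))))
                  (incr 1))))).

Lemma encode_com_runs n h st :
  1 <= n -> length h * width n <= 2 * n -> length h <= n ->
  ints st 0 1 = 0 -> listing (ints st 3) (ints st 0 6) h ->
  ints st 0 7 = width n -> ints st 0 8 = 2 ^ width n ->
  runs encode_com st (300 * n) (fun st' => string_output st' = encode_list n h).
Proof.
  intros Hn Hcost Hhn H1 H6 H7 H8.
  set (bits := fun st' i => Nat.eqb (ints st' 1 i) 1).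
  set (Frame := fun st' => listing (ints st' 3) (ints st' 0 6) h /\
     ints st' 0 7 = width n /\ ints st' 0 8 = 2 ^ width n).
  set (Inv := fun j st' => Frame st' /\ ints st' 0 4 = j /\
     listing (bits st') (ints st' 0 1) (encode_list n (firstn j h))).
  (* The bits written so far, followed by those still to come from the shifted value in cell 9, form
     the code of the first [j + 1] indices. *)
  set (Inv' := fun j e st' => Frame st' /\ ints st' 0 4 = j /\ ints st' 0 5 = e /\
     exists s, listing (bits st') (ints st' 0 1) s /\
       s ++ encode (2 ^ width n) (width n - e) (ints st' 0 9) =
       encode_list n (firstn (S j) h)).
  eapply runs_weaken.
  - apply runs_for with (N := length h) (T := 70 * width n + 30) (Inv := Inv).
    + unfold Inv, Frame. ev. rewrite H1. repeat split; auto.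
    + intros i s ((A0 & A1 & A2) & A3 & A4). split; auto. ev.
      eapply listing_length; eauto.
    + intros j s Hj ((A0 & A1 & A2) & A3 & A4). eapply runs_weaken.
      * eapply runs_seq with (T1 := 10)
          (Mid := fun st' => Inv' j 0 (step (set 5 (ICst 0)) st')).
        -- apply runs_straight; [auto|ec; lia|]. unfold Inv', Frame. ev. rewrite A3.
           pose proof (listing_nth _ _ _ j 0 A0 Hj) as Hnth. rewrite Hnth.
           repeat split; auto. eexists. split; [exact A4|].
           rewrite (firstn_snoc h j 0) by auto. unfold encode_list.
           rewrite flat_map_app, Nat.sub_0_r. cbn [flat_map]. now rewrite app_nil_r.
        -- intros s' Hs'. apply runs_for with (N := width n) (T := 50) (Inv := Inv' j).
           ++ exact Hs'.
           ++ intros i s1 ((B0 & B1 & B2) & B3 & B4 & B5). split; auto.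
           ++ intros e s1 He ((B0 & B1 & B2) & B3 & B4 & bs & B5 & B6).
              apply runs_straight; [auto|ec; lia|].
              replace (width n - e) with (S (width n - S e)) in B6 by lia.
              cbn [encode] in B6.
              unfold Inv', Frame, bits in *. ev. rewrite B2.
              destruct (Nat.ltb (ints s1 0 9 + ints s1 0 9) (2 ^ width n));
                ev; rewrite ?B2; repeat split; auto; try lia.
              ** exists (bs ++ [false]). rewrite <- app_assoc. split; auto.
                 eapply listing_snoc; [exact B5| |].
                 --- intros j' Hj'. cbn beta.
                     destruct (Nat.eqb_spec j' (ints s1 0 1)); [lia|auto].
                 --- cbn beta. now rewrite Nat.eqb_refl.
              ** exists (bs ++ [true]). rewrite <- app_assoc. split; auto.
                 eapply listing_snoc; [exact B5| |].
                 --- intros j' Hj'. cbn beta.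
                     destruct (Nat.eqb_spec j' (ints s1 0 1)); [lia|auto].
                 --- cbn beta. now rewrite Nat.eqb_refl.
      * ec. lia.
      * intros s' ((B0 & B1 & B2) & B3 & B4 & bs & B5 & B6).
        rewrite Nat.sub_diag in B6. cbn [encode] in B6. rewrite app_nil_r in B6.
        unfold Inv, Frame, bits in *. ev. subst bs. repeat split; auto. lia.
  - ec. nia.
  - intros st' (_ & _ & A). rewrite firstn_all in A. exact A.
Qed.

(** The number of coded indices is not stored: the outer loop runs until the bit position in cell 4
    reaches the length of the string. *)
Definition decode_com : com :=
  Seq (Seq (set 6 (ICst 0)) (set 4 (ICst 0)))
    (While (ILt (cell 4) (cell 1))
       (Seq (set 9 (ICst 0))
          (Seq (For 5 (cell 7)
                 (Seq (set 9 (IAdd (IAdd (cell 9) (cell 9)) (IGet 1 (cell 4)))) (incr 4)))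
               (Seq (ISet 3 (cell 6) (cell 9)) (incr 6))))).

Lemma decode_com_runs n h st :
  1 <= n -> length h * width n <= 2 * n -> length h <= n ->
  List.Forall (fun x => x < n) h ->
  ints st 0 0 = n -> ints st 0 1 = length (encode_list n h) ->
  (forall i, ints st 1 i = Nat.b2n (nth i (encode_list n h) false)) ->
  ints st 0 7 = width n ->
  runs decode_com st (300 * n)
    (fun st' => ints st' 0 0 = n /\ listing (ints st' 3) (ints st' 0 6) h /\
                reals st' = reals st).
Proof.
  intros Hn Hcost Hhn Hh H0 H1 Hbits H7.
  rewrite encode_list_length in H1.
  set (code := fun j => encode (2 ^ width n) (width n) (nth j h 0)).
  set (Frame := fun st' => ints st' 0 0 = n /\ ints st' 0 1 = length h * width n /\
     (forall i, ints st' 1 i = Nat.b2n (nth i (encode_list n h) false)) /\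
     ints st' 0 7 = width n /\ reals st' = reals st).
  set (Inv := fun j st' => Frame st' /\ ints st' 0 4 = j * width n /\
     listing (ints st' 3) (ints st' 0 6) (firstn j h)).
  set (Inv' := fun j e st' => Frame st' /\ ints st' 0 4 = j * width n + e /\
     ints st' 0 5 = e /\
     ints st' 0 9 = decode_from 0 (firstn e (code j)) /\
     listing (ints st' 3) (ints st' 0 6) (firstn j h)).
  (* A positive width ensures that the bit position is still short of the end while fewer than
     [length h] indices have been decoded. *)
  assert (Hw : 1 <= width n) by (unfold width; lia).
  eapply runs_weaken.
  - eapply runs_seq with (T1 := 10) (Mid := Inv 0).
    + apply runs_straight; [auto|ec; lia|]. unfold Inv, Frame. ev. repeat split; auto.
    + intros s0 Hs0.
      apply runs_while with (N := length h) (T := 50 * width n + 40) (Inv := Inv); auto.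
      * intros j s Hj ((A0 & A1 & A2 & A3 & A4) & A5 & A6). split.
        { ev. rewrite A1, A5. apply Nat.ltb_lt. nia. }
        eapply runs_weaken.
        -- eapply runs_seq with (T1 := 3)
             (Mid := fun st' => Inv' j 0 (step (set 5 (ICst 0)) st')).
           ++ apply runs_straight; [auto|ec; lia|]. unfold Inv', Frame. ev.
              repeat split; auto. lia.
           ++ intros s1 Hs1. eapply runs_seq.
              ** apply runs_for with (N := width n) (T := 30) (Inv := Inv' j).
                 --- exact Hs1.
                 --- intros i s2 (B0 & B1 & B2 & B3 & B4). split; auto. ev. apply B0.
                 --- intros e s2 He ((B0 & B1 & B2 & B3 & B4) & B5 & B6 & B7 & B8).
                     apply runs_straight; [auto|ec; lia|].
                     unfold Inv', Frame. ev. repeat split; auto; try lia.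
                     rewrite B2, B5, B7, (nth_encode_list n h j e false) by auto.
                     rewrite (firstn_snoc (code j) e false)
                       by (unfold code; rewrite encode_length; auto).
                     unfold decode_from. now rewrite fold_left_app.
              ** intros s2 ((B0 & B1 & B2 & B3 & B4) & B5 & B6 & B7 & B8).
                 apply runs_straight with (T := 20) (Post := Inv (S j)); [auto|ec; lia|].
                 assert (Hx : nth j h 0 < n).
                 { apply (proj1 (List.Forall_forall _ _) Hh). now apply nth_In. }
                 pose proof (Nat.log2_spec n ltac:(lia)) as [_ L2].
                 fold (width n) in L2.
                 assert (Hd : ints s2 0 9 = nth j h 0).
                 (* The prefix length [width n] is rewritten as the length of the code, so that the
                    prefix is the whole code. *)
                 { rewrite B7. rewrite <- (encode_length (2 ^ width n) (width n) (nth j h 0)) at 1.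
                   fold (code j). rewrite firstn_all. apply decode_encode; lia. }
                 unfold Inv, Frame. ev. repeat split; auto; try lia.
                 rewrite (firstn_snoc h j 0) by auto.
                 eapply listing_snoc; [exact B8| |].
                 --- intros j' Hj'. cbn beta.
                     destruct (Nat.eqb_spec j' (ints s2 0 6)); [lia|auto].
                 --- cbn beta. now rewrite Nat.eqb_refl.
        -- ec. lia.
        -- auto.
      * intros s ((A0 & A1 & A2 & A3 & A4) & A5 & A6). ev. rewrite A1, A5.
        apply Nat.ltb_irrefl.
  - ec. nia.
  - intros s ((A0 & A1 & A2 & A3 & A4) & A5 & A6). rewrite firstn_all in A6. auto.
Qed.

(** * From a list to the mixture of point masses and a uniform part *)

Definition v (j : nat) : R := (1 / (INR 3 * (INR (j + 1) * INR (j + 1))))%R.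

Definition sum_upto (f : nat -> R) (m : nat) : R := sumR (map f (seq 0 m)).

Lemma sumR_app l l' : sumR (l ++ l') = (sumR l + sumR l')%R.
Proof. induction l as [|x l IH]; simpl; [ring|]. rewrite IH. ring. Qed.

Lemma sum_upto_S f m : sum_upto f (S m) = (sum_upto f m + f m)%R.
Proof. unfold sum_upto. rewrite seq_S, map_app, sumR_app. simpl. ring. Qed.

Definition weight (h : list nat) (m i : nat) : R :=
  sum_upto (fun j => if nth j h 0 =? i then v j else 0%R) m.

Definition uniform_part (n : nat) (h : list nat) : R :=
  ((1 - sum_upto v (length h)) / INR n)%R.

Definition q_of (n : nat) (h : list nat) (i : nat) : R :=
  (uniform_part n h + weight h (length h) i)%R.

(** Point masses are scattered into real array 3 while real cell 1 keeps the mass that is left, so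
    one pass over the list and one over the indices suffice. Construction and recovery share this
    program, hence produce exactly the same [Q]. *)
Definition expand_com : com :=
  Seq (RSet 0 (ICst 1) (ROfInt (ICst 1)))
    (Seq (For 4 (cell 6)
           (Seq (RSet 3 (IGet 3 (cell 4))
                   (RAdd (RGet 3 (IGet 3 (cell 4)))
                      (RDiv (ROfInt (ICst 1))
                         (RMul (ROfInt (ICst 3))
                            (RMul (ROfInt (IAdd (cell 4) (ICst 1)))
                                  (ROfInt (IAdd (cell 4) (ICst 1))))))))
                (RSet 0 (ICst 1)
                   (RSub (RGet 0 (ICst 1))
                      (RDiv (ROfInt (ICst 1))
                         (RMul (ROfInt (ICst 3))
                            (RMul (ROfInt (IAdd (cell 4) (ICst 1)))
                                  (ROfInt (IAdd (cell 4) (ICst 1))))))))))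
         (fill 1 (RAdd (RDiv (RGet 0 (ICst 1)) (ROfInt (cell 0))) (RGet 3 (cell 4))))).

Lemma expand_com_runs n h st :
  1 <= n -> length h <= n -> ints st 0 0 = n ->
  listing (ints st 3) (ints st 0 6) h -> (forall i, reals st 3 i = 0%R) ->
  runs expand_com st (300 * n)
    (fun st' => distribution_output n st' = map (q_of n h) (seq 0 n)).
Proof.
  intros Hn Hh H0 H6 H3.
  set (Inv := fun j st' => ints st' 0 0 = n /\ ints st' 0 4 = j /\
     listing (ints st' 3) (ints st' 0 6) h /\
     (forall i, reals st' 3 i = weight h j i) /\
     reals st' 0 1 = (1 - sum_upto v j)%R).
  eapply runs_weaken with (Post := fun st' => forall i, i < n -> reals st' 1 i = q_of n h i).
  - eapply runs_seq with (T1 := 5) (Mid := fun st' => Inv 0 (step (set 4 (ICst 0)) st')).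
    + apply runs_straight; [auto|ec; lia|]. unfold Inv. ev. repeat split; auto.
      unfold sum_upto. simpl. ring.
    + intros s Hs. eapply runs_seq with (Mid := Inv (length h)).
      * apply runs_for with (N := length h) (T := 80) (Inv := Inv); [exact Hs| |].
        -- intros j s1 (A0 & A1 & A2 & A3 & A4). split; auto. ev.
           eapply listing_length; eauto.
        -- intros j s1 Hj (A0 & A1 & A2 & A3 & A4). apply runs_straight; [auto|ec; lia|].
           pose proof (listing_nth _ _ _ j 0 A2 Hj) as Hnth.
           unfold Inv, weight in *. ev. rewrite A1, A4, Hnth.
           (* [v] is written with [INR] throughout so that the evaluated program expression is
              convertible to it. *)
           change (INR 1 / (INR 3 * (INR (j + 1) * INR (j + 1))))%R with (v j).
           repeat split; auto.
           ++ lia.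
           ++ intros i. rewrite sum_upto_S, (Nat.eqb_sym (nth j h 0)), !A3.
              destruct (Nat.eqb_spec i (nth j h 0)) as [->|]; [ring|].
              ring.
           ++ rewrite sum_upto_S. ring.
      * intros s1 (A0 & A1 & A2 & A3 & A4).
        eapply runs_weaken;
          [apply fill_runs with (n := n) (f := q_of n h)|reflexivity|intros s2 H; apply H];
          auto; [ec; lia|].
        intros i s2 Hi B0 B1 B2. ev. rewrite B1, !B2, A3, A4 by lia.
        rewrite B0, A0 by lia. reflexivity.
  - ec. nia.
  - intros st' A. unfold distribution_output. apply map_ext_in.
    intros i Hi. apply in_seq in Hi. apply A. lia.
Qed.

Close Scope nat_scope.

(** * The distribution Q and its divergence *)

Lemma sum_upto_ext f g n :
  (forall i, (i < n)%nat -> f i = g i) -> sum_upto f n = sum_upto g n.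
Proof.
  induction n as [|n IH]; intro H; auto.
  rewrite !sum_upto_S, IH, H; auto.
Qed.

Lemma sum_upto_plus f g n :
  sum_upto (fun i => f i + g i) n = sum_upto f n + sum_upto g n.
Proof.
  induction n as [|n IH]; [unfold sum_upto; simpl; ring|].
  rewrite !sum_upto_S, IH. ring.
Qed.

Lemma sum_upto_const a n : sum_upto (fun _ => a) n = INR n * a.
Proof.
  induction n as [|n IH]; [unfold sum_upto; simpl; ring|].
  rewrite sum_upto_S, IH, S_INR. ring.
Qed.

Lemma sum_upto_nonneg f n :
  (forall i, (i < n)%nat -> 0 <= f i) -> 0 <= sum_upto f n.
Proof.
  induction n as [|n IH]; intro H; [unfold sum_upto; simpl; lra|].
  rewrite sum_upto_S. specialize (IH ltac:(auto)). specialize (H n ltac:(lia)). lra.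
Qed.

Lemma sum_upto_eqb f x n :
  sum_upto (fun i => if Nat.eqb x i then f i else 0) n =
  if Nat.ltb x n then f x else 0.
Proof.
  induction n as [|n IH]; [reflexivity|].
  rewrite sum_upto_S, IH.
  destruct (Nat.ltb_spec x n), (Nat.eqb_spec x n), (Nat.ltb_spec x (S n));
    try lia; subst; ring.
Qed.

(** Induction on the list for all [f] at once: after the head [x] is split off, [f] is replaced by
    [g], which vanishes at [x] and agrees with [f] on the tail by distinctness. *)
Lemma sumR_map_le_sum_upto f l n :
  NoDup l -> (forall i, In i l -> (i < n)%nat) ->
  (forall i, (i < n)%nat -> 0 <= f i) -> sumR (map f l) <= sum_upto f n.
Proof.
  intros Hl. revert f. induction Hl as [|x l Hx Hl IH]; intros f Hn Hf.
  - simpl. apply sum_upto_nonneg; auto.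
  - set (g := fun i => if Nat.eqb x i then 0 else f i).
    assert (E1 : sumR (map g l) = sumR (map f l)).
    { f_equal. apply map_ext_in. intros i Hi. unfold g.
      destruct (Nat.eqb_spec x i); [now subst|auto]. }
    assert (E2 : sum_upto f n = sum_upto g n + f x).
    { transitivity (sum_upto (fun i => g i + (if Nat.eqb x i then f i else 0)) n).
      - apply sum_upto_ext. intros i _. unfold g. destruct (Nat.eqb x i); ring.
      - rewrite sum_upto_plus, sum_upto_eqb.
        destruct (Nat.ltb_spec x n) as [_|H]; auto.
        specialize (Hn x (or_introl eq_refl)). lia. }
    simpl. rewrite E2, <- E1.
    enough (sumR (map g l) <= sum_upto g n) by lra.
    apply IH; [intros; apply Hn; now right|].
    intros i Hi. unfold g. destruct (Nat.eqb x i); [lra|auto].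
Qed.

Lemma map_nth_seq (P : list R) :
  map (fun i => nth i P 0) (seq 0 (length P)) = P.
Proof.
  induction P as [|x P IH]; auto. cbn [length seq map nth].
  f_equal. rewrite <- seq_shift, map_map. exact IH.
Qed.

(** * Masses of the mixture *)

Lemma v_pos j : 0 < v j.
Proof.
  unfold v. assert (0 < INR (j + 1)) by (apply lt_0_INR; lia).
  assert (0 < INR 3) by (apply lt_0_INR; lia).
  apply Rdiv_lt_0_compat; [lra|]. repeat apply Rmult_lt_0_compat; auto.
Qed.

(* Telescoping with [1 / (j + 1)^2 <= 1 / j - 1 / (j + 1)]. *)
Lemma sum_v_le m : sum_upto v m <= 2 / 3.
Proof.
  assert (H : forall m, sum_upto v (S m) <= 2 / 3 - 1 / (3 * INR (m + 1))).
  { induction m0 as [|k IH]; rewrite sum_upto_S.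
    - unfold sum_upto, v. simpl. lra.
    - apply Rle_trans with (2 / 3 - 1 / (3 * INR (k + 1)) + v (S k)); [lra|].
      unfold v. replace (INR 3) with 3 by (simpl; lra).
      replace (INR (S k + 1)) with (INR (k + 1) + 1)
        by (rewrite <- S_INR; f_equal; lia).
      assert (0 < INR (k + 1)) by (apply lt_0_INR; lia).
      set (x := INR (k + 1)) in *.
      apply Rminus_le. replace (_ - _) with (- (1 / (3 * x * ((x + 1) * (x + 1))))) by (field; lra).
      enough (0 < 1 / (3 * x * ((x + 1) * (x + 1)))) by lra.
      apply Rdiv_lt_0_compat; [lra|]. nra. }
  destruct m as [|m]; [unfold sum_upto; simpl; lra|].
  specialize (H m). assert (0 < INR (m + 1)) by (apply lt_0_INR; lia).
  assert (0 < 1 / (3 * INR (m + 1))) by (apply Rdiv_lt_0_compat; lra). lra.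
Qed.

Lemma weight_S h m i :
  weight h (S m) i = weight h m i + (if Nat.eqb (nth m h 0%nat) i then v m else 0).
Proof. apply sum_upto_S. Qed.

Lemma weight_nonneg h m i : 0 <= weight h m i.
Proof.
  apply sum_upto_nonneg. intros j _. pose proof (v_pos j).
  destruct (Nat.eqb _ i); lra.
Qed.

Lemma weight_notin h i : ~ In i h -> weight h (length h) i = 0.
Proof.
  intro H. unfold weight.
  rewrite (sum_upto_ext _ (fun _ => 0)); [rewrite sum_upto_const; ring|].
  intros j Hj. destruct (Nat.eqb_spec (nth j h 0%nat) i); auto.
  subst i. destruct H. now apply nth_In.
Qed.

Lemma weight_nth h j : NoDup h -> (j < length h)%nat ->
  weight h (length h) (nth j h 0%nat) = v j.
Proof.
  intros Hnd Hj. unfold weight.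
  rewrite (sum_upto_ext _ (fun j' => if Nat.eqb j j' then v j' else 0)).
  - rewrite sum_upto_eqb. destruct (Nat.ltb_spec j (length h)); [auto|lia].
  - intros j' Hj'.
    destruct (Nat.eqb_spec (nth j' h 0%nat) (nth j h 0%nat)) as [E|E],
      (Nat.eqb_spec j j') as [E'|E']; auto; [|subst; now destruct E].
    apply (proj1 (NoDup_nth h 0%nat) Hnd) in E; auto. lia.
Qed.

(** Each mass [v j] is placed on exactly one index below [n], so exchanging the two sums leaves the
    sum of the masses. *)
Lemma sum_weight h m n :
  (forall j, (j < m)%nat -> (nth j h 0 < n)%nat) ->
  sum_upto (weight h m) n = sum_upto v m.
Proof.
  induction m as [|m IH]; intro H.
  - transitivity (sum_upto (fun _ => 0) n); [reflexivity|].
    rewrite sum_upto_const. unfold sum_upto. simpl. ring.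
  - rewrite sum_upto_S, <- IH by auto.
    rewrite (sum_upto_ext _ _ n (fun i _ => weight_S h m i)), sum_upto_plus. f_equal.
    rewrite (sum_upto_eqb (fun _ => v m)).
    destruct (Nat.ltb_spec (nth m h 0%nat) n) as [_|F]; auto.
    specialize (H m). lia.
Qed.

Lemma uniform_part_ge n h : (1 <= n)%nat -> 1 / (3 * INR n) <= uniform_part n h.
Proof.
  intro Hn. unfold uniform_part. pose proof (sum_v_le (length h)).
  assert (0 < INR n) by (apply lt_0_INR; lia).
  replace (1 / (3 * INR n)) with ((1 / 3) / INR n) by (field; lra).
  apply Rmult_le_compat_r; [|lra]. left. now apply Rinv_0_lt_compat.
Qed.

Lemma q_of_distribution n h :
  (1 <= n)%nat -> (forall x, In x h -> (x < n)%nat) ->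
  distribution (map (q_of n h) (seq 0 n)).
Proof.
  intros Hn Hh. assert (0 < INR n) by (apply lt_0_INR; lia). split.
  - intros q Hq. apply in_map_iff in Hq as (i & <- & _).
    unfold q_of. pose proof (uniform_part_ge n h Hn).
    pose proof (weight_nonneg h (length h) i).
    assert (0 < 1 / (3 * INR n)) by (apply Rdiv_lt_0_compat; lra). lra.
  - change (sum_upto (q_of n h) n = 1). unfold q_of.
    rewrite sum_upto_plus, sum_upto_const, sum_weight.
    + unfold uniform_part. field. lra.
    + intros j Hj. apply Hh. now apply nth_In.
Qed.

(** * Combinatorics of the ranking *)

Lemma above_true y m : above y m = true <-> 1 < y * (m * m).
Proof. unfold above. destruct Rlt_dec; split; auto; try discriminate; tauto. Qed.

Lemma above_false y m : above y m = false <-> y * (m * m) <= 1.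
Proof.
  unfold above. destruct Rlt_dec; split; auto; try discriminate; lra.
Qed.

Lemma above_mono y m m' : 0 <= y -> (m <= m')%nat ->
  above y (INR m) = true -> above y (INR m') = true.
Proof.
  rewrite !above_true. intros Hy Hm H. eapply Rlt_le_trans; [exact H|].
  apply Rmult_le_compat_l; auto. apply le_INR in Hm. pose proof (pos_INR m). nra.
Qed.

(** For [y = p^2] with [p] a distribution: fewer than [m] indices have [p_i > 1/m]. The case [m = 1]
    says that no [y i] exceeds 1. *)
Definition sparse (n : nat) (y : nat -> R) : Prop :=
  forall l m, (1 <= m)%nat -> NoDup l ->
    (forall i, In i l -> (i < n)%nat /\ above (y i) (INR m) = true) ->
    (length l < m)%nat.

Lemma sparse_square n p :
  (forall i, (i < n)%nat -> 0 <= p i) -> sum_upto p n = 1 ->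
  sparse n (fun i => p i * p i).
Proof.
  intros Hp Hsum l m Hm Hnd Hl.
  assert (Hle : sumR (map p l) <= 1).
  { rewrite <- Hsum. apply sumR_map_le_sum_upto; auto. intros i Hi. now apply Hl. }
  assert (HmR : 0 < INR m) by (apply lt_0_INR; lia).
  (* The strict inequality between the length and [m] times the mass needs at least one element; the
     empty list is settled by [1 <= m]. *)
  destruct l as [|x l]; [simpl; lia|]. apply INR_lt.
  apply Rlt_le_trans with (INR m * sumR (map p (x :: l))); [|nra].
  assert (Hi : forall i, In i (x :: l) -> 1 < INR m * p i).
  { intros i Hi. destruct (Hl i Hi) as [Hin Ha]. apply above_true in Ha.
    specialize (Hp i Hin). assert (0 <= INR m * p i) by nra. nra. }
  clear - Hi. revert Hi.
  assert (H : (forall i, In i l -> 1 < INR m * p i) -> INR (length l) <= INR m * sumR (map p l)).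
  { induction l as [|z l IH]; intro H; [simpl; lra|].
    cbn [length map sumR fold_right]. rewrite S_INR.
    specialize (IH (fun i Hi => H i (or_intror Hi))).
    specialize (H z (or_introl eq_refl)). unfold sumR in IH. lra. }
  intro Hi. cbn [length map sumR fold_right]. rewrite S_INR.
  specialize (H (fun i Hil => Hi i (or_intror Hil))).
  specialize (Hi x (or_introl eq_refl)). unfold sumR in H. lra.
Qed.

Lemma heavy_in n t y i :
  In i (heavy n t y) <-> (i < n)%nat /\ above (y i) (INR (t + 1)) = true.
Proof.
  unfold heavy. rewrite filter_In, in_seq. intuition lia.
Qed.

Lemma heavy_NoDup n t y : NoDup (heavy n t y).
Proof. apply NoDup_filter, seq_NoDup. Qed.

Lemma heavy_length n t y : sparse n y -> (length (heavy n t y) <= t)%nat.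
Proof.
  intro H. enough (length (heavy n t y) < t + 1)%nat by lia.
  apply H; [lia|apply heavy_NoDup|]. intros i. apply heavy_in.
Qed.

Lemma bucket_in y r l i :
  In i (bucket y r l) <-> In i l /\ above (y i) (INR (r + 2)) = true /\
    above (y i) (INR (r + 1)) = false.
Proof.
  unfold bucket. rewrite filter_In, andb_true_iff, negb_true_iff. tauto.
Qed.

Section Ranking.

Variables (n : nat) (y : nat -> R) (l : list nat).
Hypothesis y_nonneg : forall i, (i < n)%nat -> 0 <= y i.
Hypothesis y_sparse : sparse n y.
Hypothesis l_NoDup : NoDup l.
Hypothesis l_lt : forall i, In i l -> (i < n)%nat.

Lemma ranking_in r i :
  In i (ranking y l r) -> In i l /\ above (y i) (INR (r + 1)) = true.
Proof.
  induction r as [|r IH]; [intros []|].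
  rewrite ranking_S, in_app_iff, bucket_in.
  replace (S r + 1)%nat with (r + 2)%nat by lia.
  intros [H|H]; [|tauto]. destruct (IH H) as [H1 H2]. split; auto.
  apply (above_mono _ (r + 1)); auto. lia.
Qed.

Lemma ranking_NoDup r : NoDup (ranking y l r).
Proof.
  induction r as [|r IH]; [constructor|].
  rewrite ranking_S. apply NoDup_app; auto.
  - apply NoDup_filter, l_NoDup.
  - intros i H1 H2. apply ranking_in in H1. apply bucket_in in H2.
    destruct H1, H2 as [_ [_ H2]]. congruence.
Qed.

(** After [r] rounds all listed indices pass the threshold [r + 1], so sparsity leaves fewer than
    [r + 1] of them. *)
Lemma ranking_length r : (length (ranking y l r) <= r)%nat.
Proof.
  enough (length (ranking y l r) < r + 1)%nat by lia.
  apply y_sparse; [lia|apply ranking_NoDup|].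
  intros i Hi. apply ranking_in in Hi as [H1 H2]. auto.
Qed.

(** An index appended in round [r] stands at a position [j <= r], since at most [r + 1] indices are
    listed by the end of that round. As it fails the threshold [r + 1], it fails the smaller
    threshold [j + 1]. *)
Lemma ranking_nth r j : (j < length (ranking y l r))%nat ->
  above (y (nth j (ranking y l r) 0%nat)) (INR (j + 1)) = false.
Proof.
  induction r as [|r IH]; [simpl; lia|].
  intro Hj. pose proof (ranking_length (S r)).
  rewrite ranking_S in *.
  destruct (Nat.lt_ge_cases j (length (ranking y l r))) as [H1|H1].
  - rewrite app_nth1 by auto. auto.
  - rewrite app_nth2 by auto. rewrite length_app in Hj.
    assert (Hb : In (nth (j - length (ranking y l r)) (bucket y r l) 0%nat) (bucket y r l))
      by (apply nth_In; lia).
    apply bucket_in in Hb as (H2 & _ & H3).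
    apply not_true_is_false. intro E. rewrite length_app in H.
    apply (above_mono _ (j + 1) (r + 1)) in E; [congruence|auto|lia].
Qed.

(** Going from threshold [r + 1] to [r + 2], an index either passed already or falls into bucket
    [r]. The base case is empty by sparsity at [m = 1]. *)
Lemma ranking_complete r i :
  In i l -> above (y i) (INR (r + 1)) = true -> In i (ranking y l r).
Proof.
  intros Hi. induction r as [|r IH]; intro Ha.
  - enough (length [i] < 1)%nat by (simpl in *; lia).
    apply y_sparse; [lia|repeat constructor; intros []|].
    intros i' [<-|[]]. auto.
  - rewrite ranking_S, in_app_iff, bucket_in.
    replace (S r + 1)%nat with (r + 2)%nat in Ha by lia.
    destruct (above (y i) (INR (r + 1))); auto.
Qed.

End Ranking.

Lemma filter_singleton (f : nat -> bool) l x :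
  NoDup l -> In x l -> (forall i, In i l -> f i = Nat.eqb i x) -> filter f l = [x].
Proof.
  intros Hnd Hx Hf. rewrite (filter_ext_in _ _ _ Hf). clear Hf.
  induction Hnd as [|z l Hz Hl IH]; [destruct Hx|]. simpl.
  destruct (Nat.eqb_spec z x) as [->|Hzx].
  - f_equal. destruct (filter _ l) as [|w m] eqn:E; auto.
    assert (Hw : In w (filter (fun i => Nat.eqb i x) l)) by (rewrite E; now left).
    apply filter_In in Hw as [Hw E']. apply Nat.eqb_eq in E'. now subst.
  - apply IH. destruct Hx; congruence.
Qed.

Lemma above_inv_square j m :
  above (1 / (INR (j + 1) * INR (j + 1))) (INR m) = Nat.ltb (j + 1) m.
Proof.
  assert (0 < INR (j + 1)) by (apply lt_0_INR; lia).
  pose proof (pos_INR m).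
  replace (above _ _) with (above (INR m * INR m / (INR (j + 1) * INR (j + 1))) 1)
    by (unfold above; replace (INR m * INR m / (INR (j + 1) * INR (j + 1)) * (1 * 1))
          with (1 / (INR (j + 1) * INR (j + 1)) * (INR m * INR m)) by (field; lra); auto).
  destruct (Nat.ltb_spec (j + 1) m) as [Hlt|Hge].
  - apply above_true. apply lt_INR in Hlt.
    rewrite !Rmult_1_r. apply Rlt_div_r; nra.
  - apply above_false. apply le_INR in Hge.
    rewrite !Rmult_1_r. apply Rle_div_l; nra.
Qed.

(** For values exactly [1/(j+1)^2], bucket [r] consists of the single entry at position [r], or is
    empty beyond the end of [h]. The rounds therefore reproduce [h] in its original order, even
    where several indices shared a bucket for [P]. *)
Lemma ranking_recovers n t y h :
  NoDup h -> (forall x, In x h -> (x < n)%nat) -> (length h <= t)%nat ->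
  (forall j, (j < length h)%nat ->
     y (nth j h 0%nat) = 1 / (INR (j + 1) * INR (j + 1))) ->
  (forall i, (i < n)%nat -> ~ In i h -> y i = 0) ->
  (length (heavy n t y) <= t)%nat /\ ranking y (heavy n t y) t = h.
Proof.
  intros Hnd Hn Ht Hy H0.
  assert (Hheavy : forall i, In i (heavy n t y) <-> In i h).
  { intro i. rewrite heavy_in. split.
    - intros [Hi Ha]. destruct (in_dec Nat.eq_dec i h) as [|Hni]; auto.
      rewrite H0, above_true in Ha by auto. lra.
    - intro Hi. split; auto. destruct (In_nth h i 0%nat Hi) as (j & Hj & <-).
      rewrite Hy, above_inv_square by auto. apply Nat.ltb_lt. lia. }
  split.
  { eapply Nat.le_trans; [|exact Ht]. apply NoDup_incl_length; [apply heavy_NoDup|].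
    intros i. apply Hheavy. }
  assert (Hb : forall r j, (j < length h)%nat ->
    (above (y (nth j h 0%nat)) (INR (r + 2)) &&
     negb (above (y (nth j h 0%nat)) (INR (r + 1))))%bool = Nat.eqb j r).
  { intros r j Hj. rewrite !Hy, !above_inv_square by auto.
    destruct (Nat.ltb_spec (j + 1) (r + 2)), (Nat.ltb_spec (j + 1) (r + 1)),
      (Nat.eqb_spec j r); simpl; auto; lia. }
  assert (H : forall r, ranking y (heavy n t y) r = firstn r h).
  { induction r as [|r IH]; auto. rewrite ranking_S, IH.
    destruct (Nat.lt_ge_cases r (length h)) as [Hr|Hr].
    - rewrite (firstn_snoc h r 0%nat) by auto. f_equal.
      apply filter_singleton; [apply heavy_NoDup|apply Hheavy; now apply nth_In|].
      intros i Hi. apply Hheavy in Hi.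
      destruct (In_nth h i 0%nat Hi) as (j & Hj & <-). rewrite Hb by auto.
      destruct (Nat.eqb_spec j r) as [->|Hjr]; [now rewrite Nat.eqb_refl|].
      symmetry. apply Nat.eqb_neq. intro E.
      apply (proj1 (NoDup_nth h 0%nat) Hnd) in E; auto.
    - rewrite !firstn_all2 by lia. unfold bucket.
      rewrite (filter_ext_in _ (fun _ => false)).
      + now rewrite filter_false, app_nil_r.
      + intros i Hi. apply Hheavy in Hi.
        destruct (In_nth h i 0%nat Hi) as (j & Hj & <-). rewrite Hb by auto.
        apply Nat.eqb_neq. lia. }
  rewrite H. now apply firstn_all2.
Qed.

(** * Size of the list and of its code *)

Lemma ceiling_exists x : 0 < x -> exists t, ceiling_spec t x.
Proof.
  intro Hx. destruct (INR_unbounded x) as [N HN]. apply Rlt_le in HN.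
  induction N as [|N IH]; [simpl in HN; lra|].
  destruct (Rlt_le_dec (INR N) x) as [H|H]; auto.
  exists N. split; auto. now rewrite Nat.add_1_r.
Qed.

(** Here [c >= 1] enters through [2 / (c + 1) <= 1]. *)
Lemma root_square_le n c : (1 <= n)%nat -> 1 <= c -> root n c * root n c <= INR n.
Proof.
  intros Hn Hc. unfold root. rewrite <- Rpower_plus.
  assert (H1 : 1 <= INR n) by (now apply (le_INR 1)).
  rewrite <- (Rpower_1 (INR n)) at 2 by lra.
  apply Rle_Rpower; auto.
  replace (1 / (c + 1) + 1 / (c + 1)) with (2 / (c + 1)) by (field; lra).
  apply Rle_div_l; lra.
Qed.

Lemma ceiling_root_bounds n c t : (1 <= n)%nat -> 1 <= c ->
  ceiling_spec t (root n c) -> (t * t < n)%nat.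
Proof.
  intros Hn Hc [Ht _]. apply INR_lt. rewrite mult_INR.
  pose proof (root_square_le n c Hn Hc). pose proof (pos_INR t). nra.
Qed.

Lemma Int_part_ge z x : IZR z <= x -> (z <= Int_part x)%Z.
Proof.
  intro H. destruct (base_Int_part x) as [_ H1].
  apply Z.lt_succ_r, lt_IZR. unfold Z.succ. rewrite plus_IZR. lra.
Qed.

Lemma ln_2_pos : 0 < ln 2.
Proof. rewrite <- ln_1. apply ln_increasing; lra. Qed.

Lemma log2_nat_le n : (1 <= n)%nat -> INR (Nat.log2 n) <= log2 (INR n).
Proof.
  intro Hn. pose proof ln_2_pos. destruct (Nat.log2_spec n ltac:(lia)) as [H1 _].
  apply le_INR in H1. rewrite pow_INR in H1. replace (INR 2) with 2 in H1 by (simpl; lra).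
  unfold log2. apply Rle_div_r; auto. rewrite <- ln_pow by lra.
  apply ln_le; auto. apply pow_lt. lra.
Qed.

Lemma width_square_le n : (1 <= n)%nat -> (width n * width n <= 3 * n)%nat.
Proof.
  intro Hn. pose proof (Nat.log2_spec n ltac:(lia)) as [H1 _].
  enough (forall l, (S l * S l <= 3 * 2 ^ l)%nat) as H.
  { specialize (H (Nat.log2 n)). unfold width. lia. }
  (* Doubling the bound dominates the growth of the square only from exponent 2 on, so the first
     three values are checked directly. *)
  induction l as [|[|[|l]] IH]; cbn [Nat.pow] in *; try lia.
Qed.

(** As [t] is a natural number below the root, it is at most the floor of the root; likewise
    [Nat.log2 n] is at most the floor of the real logarithm. *)
Lemma code_length_le n c t k : (1 <= n)%nat -> 1 <= c ->
  ceiling_spec t (root n c) -> (k <= t)%nat ->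
  (Z.of_nat (k * width n) <=
     Int_part (Rpower (INR n) (1 / (c + 1))) * (Int_part (log2 (INR n)) + 1))%Z.
Proof.
  intros Hn Hc [Ht _] Hk.
  assert (H1 : (Z.of_nat t <= Int_part (root n c))%Z).
  { apply Int_part_ge. rewrite <- INR_IZR_INZ. lra. }
  assert (H2 : (Z.of_nat (Nat.log2 n) <= Int_part (log2 (INR n)))%Z).
  { apply Int_part_ge. rewrite <- INR_IZR_INZ. now apply log2_nat_le. }
  unfold root in H1. rewrite Nat2Z.inj_mul. unfold width. rewrite Nat2Z.inj_succ.
  apply Z.mul_le_mono_nonneg; lia.
Qed.

(** * The divergence bound *)

Lemma relative_entropy_term_le p q c :
  0 <= p -> (0 < p -> 0 < q /\ (c + 1) * ln p - ln 3 <= ln q) ->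
  Rbar_le (relative_entropy_term p q)
    (Finite (c * (p * log2 (1 / p)) + p * log2 (PI ^ 2 / 3))).
Proof.
  intros Hp Hq. unfold relative_entropy_term.
  destruct (Req_EM_T p 0) as [->|Hp0]; [simpl; lra|].
  destruct Hq as [Hq0 Hq]; [lra|].
  destruct (Req_EM_T q 0) as [|_]; [lra|]. unfold log2. simpl Rbar_le.
  pose proof ln_2_pos.
  rewrite (ln_div p q), (ln_div 1 p), ln_1 by lra.
  (* This is [9 <= PI^2], from [3/2 < PI/2]. *)
  assert (HPI : ln 3 <= ln (PI * (PI * 1) / 3)).
  { apply ln_le; [lra|]. pose proof PI2_3_2. apply Rle_div_r; nra. }
  replace (c * (p * ((0 - ln p) / ln 2)) + p * (ln (PI * (PI * 1) / 3) / ln 2))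
    with (p * ((ln (PI * (PI * 1) / 3) - c * ln p) / ln 2)) by (field; lra).
  apply Rmult_le_compat_l; auto. apply Rmult_le_compat_r; [|lra].
  left. now apply Rinv_0_lt_compat.
Qed.

(** The constant is weighted by the partial mass of [l], which makes the bound additive and provable
    term by term; the mass is 1 for the full distribution. *)
Lemma relative_entropy_le (p q : nat -> R) c l :
  (forall i, In i l -> 0 <= p i /\
     (0 < p i -> 0 < q i /\ (c + 1) * ln (p i) - ln 3 <= ln (q i))) ->
  Rbar_le (relative_entropy (map p l) (map q l))
    (Finite (c * entropy (map p l) + sumR (map p l) * log2 (PI ^ 2 / 3))).
Proof.
  induction l as [|i l IH]; intro H.
  - unfold relative_entropy, entropy, sumR. simpl. lra.
  - specialize (IH (fun j Hj => H j (or_intror Hj))).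
    destruct (H i (or_introl eq_refl)) as [H1 H2].
    pose proof (relative_entropy_term_le _ _ c H1 H2) as HT.
    pose proof (Rbar_plus_le_compat _ _ _ _ HT IH) as HS.
    unfold relative_entropy, entropy, sumR in *. cbn [map combine fold_right fst snd].
    eapply Rbar_le_trans; [exact HS|]. cbn [Rbar_plus Rbar_plus' Rbar_le]. right. ring.
Qed.

Lemma distribution_length P : distribution P -> (1 <= length P)%nat.
Proof. intros [_ H]. destruct P; simpl in *; [lra|lia]. Qed.

Lemma distribution_sparse P :
  distribution P -> sparse (length P) (fun i => nth i P 0 * nth i P 0).
Proof.
  intros [H0 H1]. apply sparse_square.
  - intros i Hi. now apply H0, nth_In.
  - unfold sum_upto. now rewrite map_nth_seq.
Qed.

Section Divergence.

Variables (P : list R) (c : R) (t : nat).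
Let n := length P.
Let p (i : nat) := nth i P 0.
Let y (i : nat) := p i * p i.
Let h := ranking y (heavy n t y) t.
Hypothesis P_distribution : distribution P.
Hypothesis c_ge1 : 1 <= c.
Hypothesis t_ceiling : ceiling_spec t (root n c).

Let y_sparse : sparse n y := distribution_sparse P P_distribution.

Lemma square_nonneg i : (i < n)%nat -> 0 <= y i.
Proof. intros _. unfold y. apply Rle_0_sqr. Qed.

Lemma rank_NoDup : NoDup h.
Proof.
  apply ranking_NoDup with (n := n); auto using square_nonneg, heavy_NoDup.
  intros i Hi. apply heavy_in in Hi. tauto.
Qed.

Lemma rank_lt i : In i h -> (i < n)%nat.
Proof.
  intro Hi. apply (ranking_in n) in Hi as [Hi _]; auto using square_nonneg;
    [|clear i Hi; intros i Hi]; apply heavy_in in Hi; tauto.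
Qed.

Lemma rank_length : (length h <= t)%nat.
Proof.
  apply ranking_length with (n := n);
    auto using square_nonneg, heavy_NoDup, y_sparse.
  intros i Hi. apply heavy_in in Hi. tauto.
Qed.

Lemma q_of_ge i : (i < n)%nat -> 0 < p i ->
  0 < q_of n h i /\ (c + 1) * ln (p i) - ln 3 <= ln (q_of n h i).
Proof.
  intros Hi Hp. pose proof (distribution_length P P_distribution) as Hn. fold n in Hn.
  assert (HnR : 0 < INR n) by (apply lt_0_INR; lia).
  pose proof (uniform_part_ge n h Hn) as HU.
  assert (HU0 : 0 < 1 / (3 * INR n)) by (apply Rdiv_lt_0_compat; lra).
  pose proof (weight_nonneg h (length h) i) as HW.
  split; [unfold q_of; lra|].
  assert (Hlt : forall i, In i (heavy n t y) -> (i < n)%nat)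
    by (intros z Hz; apply heavy_in in Hz; tauto).
  assert (Hp1 : p i <= 1).
  (* Sparsity at [m = 1], applied to the singleton list. *)
  { assert (E : above (y i) (INR 1) = false).
    { destruct (above (y i) (INR 1)) eqn:E; auto.
      assert (length [i] < 1)%nat; [|simpl in *; lia].
      apply y_sparse; [lia|repeat constructor; intros []|].
      intros z [<-|[]]. auto. }
    apply above_false in E. unfold y in E. simpl in E. nra. }
  assert (Hln : ln (p i) <= 0) by (rewrite <- ln_1; apply ln_le; lra).
  destruct (above (y i) (INR (t + 1))) eqn:E.
  - assert (Hh : In i h).
    { apply ranking_complete with (n := n); auto using y_sparse.
      apply heavy_in. auto. }
    destruct (In_nth h i 0%nat Hh) as (j & Hj & Hji).
    assert (Ha : above (y i) (INR (j + 1)) = false).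
    { rewrite <- Hji. apply ranking_nth with (n := n);
        auto using square_nonneg, heavy_NoDup, y_sparse. }
    apply above_false in Ha. unfold y in Ha.
    assert (Hw : weight h (length h) i = v j)
      by (rewrite <- Hji; apply weight_nth; auto using rank_NoDup).
    (* For a listed index, [p_i^(c+1) <= p_i^2] because [p_i <= 1] and [c + 1 >= 2], and the point
       mass is at least [p_i^2 / 3]. *)
    apply Rle_trans with (ln (p i * p i / 3)).
    + rewrite ln_div, ln_mult by nra. nra.
    + apply ln_le; [nra|]. unfold q_of. rewrite Hw.
      enough (p i * p i / 3 <= v j) by lra. unfold v.
      replace (INR 3) with 3 by (simpl; lra).
      assert (0 < INR (j + 1)) by (apply lt_0_INR; lia).
      set (z := INR (j + 1) * INR (j + 1)) in *. assert (0 < z) by (unfold z; nra).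
      apply Rle_div_r in Ha; auto.
      replace (1 / (3 * z)) with (1 / z / 3) by (field; lra). lra.
  - apply above_false in E. unfold y in E. destruct t_ceiling as [_ Ht].
    assert (0 < INR (t + 1)) by (apply lt_0_INR; lia).
    (* For an unlisted index, [p_i <= 1/(t+1)] and the root is at most [t + 1]. Raising to the power
       [c + 1], in logarithms, gives [p_i^(c+1) <= 1/n]. *)
    assert (Hpr : p i * root n c <= 1).
    { apply Rle_trans with (p i * INR (t + 1)); [nra|].
      assert (0 < p i * INR (t + 1)) by nra. nra. }
    assert (Hr : 0 < root n c) by apply exp_pos.
    apply ln_le in Hpr; [|nra]. rewrite ln_mult, ln_1 in Hpr by auto.
    unfold root in Hpr. rewrite ln_Rpower in Hpr.
    assert (Hc : (c + 1) * (ln (p i) + 1 / (c + 1) * ln (INR n)) <= 0) by nra.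
    replace ((c + 1) * (ln (p i) + 1 / (c + 1) * ln (INR n)))
      with ((c + 1) * ln (p i) + ln (INR n)) in Hc by (field; lra).
    apply Rle_trans with (ln (1 / (3 * INR n))).
    + rewrite ln_div, ln_mult, ln_1 by lra. lra.
    + apply ln_le; auto. unfold q_of. lra.
Qed.

Lemma divergence_le :
  Rbar_le (relative_entropy P (map (q_of n h) (seq 0 n)))
    (Finite (c * entropy P + log2 (PI ^ 2 / 3))).
Proof.
  pose proof (relative_entropy_le p (q_of n h) c (seq 0 n)) as H.
  assert (E : map p (seq 0 n) = P) by apply map_nth_seq.
  rewrite E in H. rewrite (proj2 P_distribution), Rmult_1_l in H. apply H.
  intros i Hi. apply in_seq in Hi. split.
  { apply P_distribution, nth_In. subst n. lia. }
  intro Hp. apply q_of_ge; auto. lia.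
Qed.

End Divergence.

(** * Assembling the programs *)

Definition construct_com : com :=
  Seq (fill 2 (RMul (RGet 1 (cell 4)) (RGet 1 (cell 4))))
    (Seq rank_com expand_com).

(* [q_i - min q] is [1 / (3 (j + 1)^2)] if [i] has rank [j], so that ranking
   [3 (q_i - min q)] recovers the list from [q]. *)
Definition store_com : com :=
  Seq compute_min
    (Seq (fill 2 (RMul (ROfInt (ICst 3)) (RSub (RGet 1 (cell 4)) (RGet 0 (ICst 1)))))
       (Seq rank_com (Seq compute_bits encode_com))).

Definition recover_com : com := Seq compute_bits (Seq decode_com expand_com).

Lemma construct_com_runs P c t (n := length P)
    (y := fun i => nth i P 0 * nth i P 0) (h := ranking y (heavy n t y) t) :
  distribution P -> 1 <= c -> ceiling_spec t (root n c) ->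
  computes_within construct_com (distribution_input c P) (distribution_output n)
    (1000 * n) (map (q_of n h) (seq 0 n)).
Proof.
  intros HP Hc Ht.
  pose proof (distribution_length P HP) as Hn. fold n in Hn.
  pose proof (ceiling_root_bounds n c t Hn Hc Ht) as Htn.
  pose proof (rank_length P t HP : (length h <= t)%nat) as Hh.
  eapply runs_weaken with (Post := fun st => distribution_output n st = map (q_of n h) (seq 0 n)).
  - eapply runs_seq.
    + apply fill_runs with (n := n) (f := y); auto; [ec; lia|].
      intros i st Hi H1 H2 H3. ev. rewrite H2, H3 by lia. reflexivity.
    + intros s1 (A1 & A2 & A3). eapply runs_seq.
      * apply (rank_com_runs n 0 t c y); auto; [lia|].
        apply heavy_length, distribution_sparse, HP.
      * intros s2 (B0 & B1 & B2 & B3).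
        apply expand_com_runs; [auto|fold h; nia|auto|exact B3|].
        (* Real array 3 is still zero, as [expand_com] requires: only array 2 has been written. *)
        intro i. rewrite B2, A2; auto.
  - lia.
  - auto.
Qed.

(** By pigeonhole some index is not listed, and it carries the uniform part alone. *)
Lemma min_q_of n h : (length h < n)%nat ->
  exists i, (i < n)%nat /\ q_of n h i = uniform_part n h.
Proof.
  intro Hh.
  destruct (Exists_dec (fun i => ~ In i h) (seq 0 n)) as [H|H].
  - intro i. destruct (in_dec Nat.eq_dec i h); tauto.
  - apply Exists_exists in H as (i & Hi & Hni). apply in_seq in Hi.
    exists i. split; [lia|]. unfold q_of. rewrite weight_notin; auto. ring.
  - exfalso. apply (Nat.lt_irrefl n). eapply Nat.le_lt_trans; [|exact Hh].
    rewrite <- (length_seq n 0) at 1. apply NoDup_incl_length; [apply seq_NoDup|].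
    intros i Hi. destruct (in_dec Nat.eq_dec i h) as [|Hni]; auto.
    destruct H. apply Exists_exists. eauto.
Qed.

Lemma nth_map_seq f n i d : (i < n)%nat -> nth i (map f (seq 0 n)) d = f i :> R.
Proof.
  intro Hi. rewrite nth_indep with (d' := f 0%nat) by now rewrite length_map, length_seq.
  now rewrite map_nth, seq_nth.
Qed.

(** With [w = width n], [2 k w <= k^2 + w^2 <= n + 3 n]. *)
Lemma list_code_cost n t k : (1 <= n)%nat -> (t * t < n)%nat -> (k <= t)%nat ->
  (k * width n <= 2 * n)%nat.
Proof.
  intros Hn Ht Hk.
  pose proof (width_square_le n Hn).
  assert (k * k <= t * t)%nat by (apply Nat.mul_le_mono; auto).
  assert (2 * (k * width n) <= k * k + width n * width n)%nat; [|lia].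
  destruct (Nat.le_ge_cases k (width n)); nia.
Qed.

(** The list has to be found again from [Q] and [c] alone: [t] is recomputed from [n] and [c], and
    [ranking_recovers] applies to the rescaled excess of [Q] over its minimum. *)
Lemma store_com_runs n c t h :
  (1 <= n)%nat -> 1 <= c -> ceiling_spec t (root n c) ->
  NoDup h -> (forall x, In x h -> (x < n)%nat) -> (length h <= t)%nat ->
  computes_within store_com (distribution_input c (map (q_of n h) (seq 0 n)))
    string_output (1000 * n) (encode_list n h).
Proof.
  intros Hn Hc Ht Hnd Hlt Hh.
  pose proof (ceiling_root_bounds n c t Hn Hc Ht) as Htn.
  set (y := fun i => INR 3 * (q_of n h i - uniform_part n h)).
  assert (Hy : forall i, y i = INR 3 * weight h (length h) i)
    by (intro i; unfold y, q_of; ring).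
  destruct (ranking_recovers n t y h Hnd Hlt Hh) as [Hheavy Hrank].
  { intros j Hj. rewrite Hy, weight_nth by auto. unfold v.
    assert (0 < INR (j + 1)) by (apply lt_0_INR; lia).
    assert (0 < INR 3) by (apply lt_0_INR; lia). field. lra. }
  { intros i _ Hi. rewrite Hy, weight_notin by auto. ring. }
  eapply runs_weaken with (Post := fun st => string_output st = encode_list n h).
  - eapply runs_seq.
    + apply (compute_min_runs n 0 c (q_of n h) (uniform_part n h)); auto.
      * cbn [distribution_input ints]. now rewrite length_map, length_seq.
      * intros i Hi. apply nth_map_seq, Hi.
      * intros i _. unfold q_of. pose proof (weight_nonneg h (length h) i). lra.
      * apply min_q_of. nia.
    + intros s1 (A0 & A1 & A2 & A3 & A4). eapply runs_seq.
      * apply fill_runs with (n := n) (f := y); auto; [ec; lia|].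
        intros i st Hi H1 H2 H3. ev. rewrite H2, !H3, A3, A4 by lia. reflexivity.
      * intros s2 (B1 & B2 & B3). eapply runs_seq.
        -- apply (rank_com_runs n 0 t c y); auto; try lia.
           ++ rewrite B2; auto.
           ++ rewrite B1; auto.
           ++ rewrite B1; auto.
        -- rewrite Hrank. intros s3 (C0 & C1 & C2 & C3). eapply runs_seq.
           ++ apply (compute_bits_runs n 0); auto.
           ++ intros s4 (D0 & D1 & D2 & D3 & D4 & D5 & D6).
              apply encode_com_runs; auto.
              ** apply (list_code_cost n t); auto.
              ** nia.
              ** rewrite D3. eapply listing_ext; [exact C3|auto].
  - lia.
  - auto.
Qed.

Lemma recover_com_runs n c h :
  (1 <= n)%nat -> (length h <= n)%nat -> (length h * width n <= 2 * n)%nat ->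
  (forall x, In x h -> (x < n)%nat) ->
  computes_within recover_com (string_input n c (encode_list n h))
    (distribution_output n) (1000 * n) (map (q_of n h) (seq 0 n)).
Proof.
  intros Hn Hh Hcost Hlt.
  eapply runs_weaken with (Post := fun st => distribution_output n st = map (q_of n h) (seq 0 n)).
  - eapply runs_seq.
    + apply (compute_bits_runs n (length (encode_list n h))); auto.
    + intros s1 (A0 & A1 & A2 & A3 & A4 & A5 & A6). eapply runs_seq.
      * apply (decode_com_runs n h); auto.
        now apply List.Forall_forall.
      * intros s2 (B0 & B1 & B2). apply expand_com_runs; auto.
        intro i. rewrite B2, A4. reflexivity.
  - lia.
  - auto.
Qed.

Theorem theorem4 :
  exists (construct store recover : com) (K : nat),
  forall (P : list R) (c : R),
    distribution P -> 1 <= c ->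
    let n := length P in
    exists (Q : list R) (s : list bool),
      distribution Q /\ length Q = n /\
      Rbar_le (relative_entropy P Q)
              (Finite (c * entropy P + log2 (PI ^ 2 / 3))) /\
      (Z.of_nat (length s) <=
         Int_part (Rpower (INR n) (1 / (c + 1)))
         * (Int_part (log2 (INR n)) + 1))%Z /\
      computes_within construct (distribution_input c P)
        (distribution_output n) (K * n) Q /\
      computes_within store (distribution_input c Q)
        string_output (K * n) s /\
      computes_within recover (string_input n c s)
        (distribution_output n) (K * n) Q.
Proof.
  (* The bounds of the components add up to 860, 980 and 660 times [n]. *)
  exists construct_com, store_com, recover_com, 1000%nat.
  intros P c HP Hc n.
  pose proof (distribution_length P HP) as Hn. fold n in Hn.
  destruct (ceiling_exists (root n c)) as [t Ht]; [apply exp_pos|].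
  pose proof (ceiling_root_bounds n c t Hn Hc Ht) as Htn.
  set (y := fun i => nth i P 0 * nth i P 0).
  set (h := ranking y (heavy n t y) t).
  assert (Hlen : (length h <= t)%nat) by now apply rank_length.
  assert (Hlt : forall x, In x h -> (x < n)%nat) by (intro x; now apply rank_lt).
  assert (Hcost : (length h * width n <= 2 * n)%nat)
    by now apply (list_code_cost n t).
  exists (map (q_of n h) (seq 0 n)), (encode_list n h).
  split; [now apply q_of_distribution|].
  split; [now rewrite length_map, length_seq|].
  split; [now apply divergence_le|].
  split; [rewrite encode_list_length; now apply code_length_le with (t := t)|].
  split; [now apply construct_com_runs|].
  split; [apply store_com_runs with (t := t); auto; now apply rank_NoDup|].
  apply recover_com_runs; auto. nia.
Qed.
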